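(* For all $\alpha,\beta>-1$, the orthonormal system $\{\varphi_m^{(\alpha,\beta)}\}_{m\in\mathbb{Z}_+}$ of tanh-Jacobi functions is complete in $L_2(\mathbb{R})$ (i.e. it is an orthonormal basis of $L_2(\mathbb{R})$).
   Context: $\mathbb{Z}_+=\{0,1,2,\ldots\}$. $P_m^{(\alpha,\beta)}$ is the $m$th Jacobi polynomial in the standard normalisation, $g_m^{(\alpha,\beta)}=\int_{-1}^1(1-t)^\alpha(1+t)^\beta[P_m^{(\alpha,\beta)}(t)]^2\,dt$, and the tanh-Jacobi functions are $$\varphi_m^{(\alpha,\beta)}(x)=\frac{(-1)^m}{\sqrt{g_m^{(\alpha,\beta)}}}(1-\tanh x)^{\frac{\alpha+1}{2}}(1+\tanh x)^{\frac{\beta+1}{2}}P_m^{(\alpha,\beta)}(\tanh x),\qquad m\in\mathbb{Z}_+,\ x\in\mathbb{R}.$$ *)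

(* Defs.v *)
From HB Require Import structures.
From mathcomp Require Import all_boot all_order all_algebra.
From mathcomp Require Import all_classical all_reals all_analysis.
Import Order.TTheory GRing.Theory Num.Theory.
Import numFieldNormedType.Exports.

Set Implicit Arguments.
Unset Strict Implicit.
Unset Printing Implicit Defensive.

Local Open Scope classical_set_scope.
Local Open Scope ring_scope.

Definition pochhammer (R : realType) (a : R) (n : nat) : R :=
  \prod_(i < n) (a + i%:R).

(* P_m^(alpha,beta)(t) =
     (alpha+1)_m / m! * 2F1(-m, m+alpha+beta+1; alpha+1; (1-t)/2),
   so that P_m^(alpha,beta)(1) = (alpha+1)_m / m!.  The denominators do not
   vanish when alpha > -1. *)
Definition jacobi (R : realType) (alpha beta : R) (m : nat) : {poly R} :=
  (pochhammer (alpha + 1) m / m`!%:R) *: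
  \sum_(k < m.+1)
    (pochhammer (- m%:R) k * pochhammer (m%:R + alpha + beta + 1) k /
     (pochhammer (alpha + 1) k * k`!%:R)) *: (2^-1 *: (1 - 'X)) ^+ k.

(* [powR] gives the weight a spurious finite value at an endpoint where the
   exponent is negative; this affects a null set only. *)
Definition jacobi_sqnorm (R : realType) (alpha beta : R) (m : nat) : R :=
  \int[@lebesgue_measure R]_(t in `[-1, 1])
    ((1 - t) `^ alpha * (1 + t) `^ beta * (jacobi alpha beta m).[t] ^+ 2).

Definition tanh (R : realType) (x : R) : R :=
  (expR x - expR (- x)) / (expR x + expR (- x)).

Definition tanh_jacobi (R : realType) (alpha beta : R) (m : nat) (x : R) : R :=
  (-1) ^+ m / Num.sqrt (jacobi_sqnorm alpha beta m) *
  (1 - tanh x) `^ ((alpha + 1) / 2) * (1 + tanh x) `^ ((beta + 1) / 2) *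
  (jacobi alpha beta m).[tanh x].

(* Elements of the real Hilbert space L_2(R) are represented by square-integrable
   measurable functions, i.e. by [f \in L2 R]; equality in L_2(R) is vanishing of
   the L2 distance. *)
Definition L2 (R : realType) : {pred R -> R} :=
  Lfun (@lebesgue_measure R) 2%:E.
Arguments L2 R : clear implicits.

Definition L2dist (R : realType) (f g : R -> R) : \bar R :=
  'N[@lebesgue_measure R]_2%:E[EFin \o (f \- g)%R]%E.

Definition L2dot (R : realType) (f g : R -> R) : R :=
  \int[@lebesgue_measure R]_x (f x * g x).

Definition orthonormal_system (R : realType) (phi : nat -> R -> R) : Prop :=
  (forall m, phi m \in L2 R) /\
  (forall m n, L2dot (phi m) (phi n) = (m == n)%:R).

(* The finite linear combinations of [phi] are dense in L_2(R). *)
Definition complete_system (R : realType) (phi : nat -> R -> R) : Prop :=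
  forall f, f \in L2 R -> forall e : R, 0 < e ->
    exists (n : nat) (c : nat -> R),
      (L2dist f (fun x => \sum_(m < n) c m * phi m x)%R < e%:E)%E.

(* Every f is the sum in L_2(R) of its Fourier series along [phi]. *)
Definition orthonormal_basis (R : realType) (phi : nat -> R -> R) : Prop :=
  orthonormal_system phi /\
  (forall f, f \in L2 R ->
    L2dist f (fun x => \sum_(m < n) L2dot f (phi m) * phi m x)
      @[n --> \oo] --> 0%E).

(* Main.v *)
Require Import Defs.
From mathcomp Require Import all_boot all_order all_algebra.
From mathcomp Require Import all_classical all_reals all_analysis.
From mathcomp Require Import measurable_realfun.
From mathcomp Require Import ring lra.
Import Order.TTheory GRing.Theory Num.Theory.
Import numFieldNormedType.Exports.

Set Implicit Arguments.
Unset Strict Implicit.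
Unset Printing Implicit Defensive.

Local Open Scope classical_set_scope.
Local Open Scope ring_scope.


(** Under [t = tanh x] one has [dt = (1 - t^2) dx], so the product of two
    tanh-Jacobi functions is, up to constants, [W(x) P_m(t) P_n(t)] with
    [W = (1-t)^a (1+t)^b], [a = alpha + 1 > 0] and [b = beta + 1 > 0].

    Orthogonality.  For every polynomial [s] the derivative in [x] of [W s(t)]
    is [W T(t)] for an explicit polynomial [T], the flux of [s]
    ([is_derive_flux]).  As [W] vanishes at both ends, fluxes integrate to zero
    ([Rintegral_flux]).  The hypergeometric recurrence gives the Jacobi
    differential equation ([jacobi_ode]), which says that the flux of the
    Wronskian of [P_m] and [P_n] is [P_m P_n] times the difference of their
    eigenvalues, which is not 0 when [m] and [n] differ
    ([jacobi_flux_wronskian], [jacobi_eigenvalue_inj]).  The squared norm is carried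
    from [[-1, 1]] to the line by the substitution [t = tanh x] on compact
    intervals ([integral_jacobi_weight]).

    Completeness.  The Jacobi polynomials have degrees 0, 1, 2, ... and span all
    polynomials, so it suffices to approximate a square-integrable [f] by
    [w(x) p(tanh x)] where [w^2 = W].  By truncation one may take [f = w u] with
    [u] bounded and of bounded support; then [u] is close in mean to a
    continuous function of compact support, which has the form [h(tanh x)] with
    [h] continuous on the line ([factor_through_tanh]); by Weierstrass [h] is
    uniformly close on [[-1, 1]] to a polynomial, and the integrability of [W]
    turns this into closeness in mean square.

    Basis.  Among the combinations of the first functions of an orthonormal
    system the Fourier sum is the best approximation, so density of the
    combinations forces convergence of the Fourier series
    ([orthonormal_complete_basis]). *)

(** * Jacobi polynomials: degree and differential equation *)

Lemma pochhammerS (R : realType) (a : R) n :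
  pochhammer a n.+1 = pochhammer a n * (a + n%:R).
Proof. by rewrite /pochhammer big_ord_recr. Qed.

Lemma pochhammer_neq0 (R : realType) (a : R) n :
  (forall i, (i < n)%N -> a + i%:R != 0) -> pochhammer a n != 0.
Proof. by move=> h; apply/prodf_neq0 => i _; apply: h. Qed.

Lemma pochhammerN_eq0 (R : realType) (m k : nat) :
  (m < k)%N -> pochhammer (- m%:R : R) k = 0.
Proof.
move=> mk; apply/eqP/prodf_eq0; exists (Ordinal mk) => //=.
by rewrite addNr.
Qed.

(** Coefficient of the terminating hypergeometric series 2F1(-m, m+alpha+beta+1;
    alpha+1; y). *)
Definition hyp_coef (R : realType) (alpha beta : R) (m k : nat) : R :=
  pochhammer (- m%:R) k * pochhammer (m%:R + alpha + beta + 1) k /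
     (pochhammer (alpha + 1) k * k`!%:R).

Lemma hyp_coefS (R : realType) (alpha beta : R) (m k : nat) : -1 < alpha ->
  k.+1%:R * (alpha + 1 + k%:R) * hyp_coef alpha beta m k.+1 =
  (k%:R - m%:R) * (m%:R + alpha + beta + 1 + k%:R) * hyp_coef alpha beta m k.
Proof.
move=> ha; rewrite /hyp_coef !pochhammerS factS natrM.
have h1 : alpha + 1 + k%:R != 0.
  by rewrite gt_eqF// ltr_wpDr ?ler0n//; lra.
have h2 : pochhammer (alpha + 1) k != 0.
  by apply: pochhammer_neq0 => i _; rewrite gt_eqF// ltr_wpDr ?ler0n//; lra.
have h3 : k`!%:R != 0 :> R by rewrite pnatr_eq0 -lt0n fact_gt0.
have h4 : k.+1%:R != 0 :> R by rewrite pnatr_eq0.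
by field; rewrite nat1r h1 h2 h3 h4.
Qed.

Definition hyp_poly (R : realType) (alpha beta : R) (m : nat) : {poly R} :=
  \poly_(k < m.+1) hyp_coef alpha beta m k.

(** The coefficients of index above [m] vanish with the factor [(-m)_k], so the
    recurrence [hyp_coefS] can be used at every index. *)
Lemma coef_hyp_poly (R : realType) (alpha beta : R) (m k : nat) :
  (hyp_poly alpha beta m)`_k = hyp_coef alpha beta m k.
Proof.
rewrite coef_poly ltnS; case: leqP => // mk.
by rewrite /hyp_coef pochhammerN_eq0// !mul0r.
Qed.

Definition half_flip (R : realType) : {poly R} := 2^-1 *: (1 - 'X).

Lemma jacobiE (R : realType) (alpha beta : R) (m : nat) :
  jacobi alpha beta m = (pochhammer (alpha + 1) m / m`!%:R) *:
    (hyp_poly alpha beta m \Po half_flip R).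
Proof.
congr (_ *: _); rewrite /hyp_poly poly_def raddf_sum /=.
by apply: eq_bigr => k _; rewrite linearZ /= rmorphXn /= comp_polyX.
Qed.

Lemma size_half_flip (R : realType) : size (half_flip R) = 2.
Proof.
rewrite /half_flip size_scale ?invr_eq0 ?pnatr_eq0//.
by rewrite -opprB size_polyN size_XsubC.
Qed.

Lemma size_jacobi (R : realType) (alpha beta : R) (m : nat) :
  -1 < alpha -> -1 < beta -> size (jacobi alpha beta m) = m.+1.
Proof.
move=> ha hb; rewrite jacobiE size_scale; last first.
  rewrite mulf_neq0 ?invr_eq0 ?pnatr_eq0 -?lt0n ?fact_gt0//.
  by apply: pochhammer_neq0 => i _; rewrite gt_eqF// ltr_wpDr ?ler0n//; lra.
rewrite size_comp_poly2 ?size_half_flip// size_poly_eq// /hyp_coef.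
rewrite mulf_neq0 ?mulf_neq0 ?invr_eq0 ?mulf_neq0//.
- apply: pochhammer_neq0 => i im.
  by rewrite addrC subr_eq0 eqr_nat ltn_eqF.
- apply: pochhammer_neq0 => i im; rewrite gt_eqF//.
  have : (1 : R) <= m%:R by rewrite ler1n (leq_ltn_trans _ im).
  by have : (0 : R) <= i%:R by []; lra.
- by apply: pochhammer_neq0 => i _; rewrite gt_eqF// ltr_wpDr ?ler0n//; lra.
Qed.

Definition jacobi_eigenvalue (R : realType) (alpha beta : R) (m : nat) : R :=
  m%:R * (m%:R + alpha + beta + 1).

Lemma coefX_deriv (R : realType) (p : {poly R}) k : ('X * p^`())`_k = k%:R * p`_k.
Proof.
rewrite coefXM coef_deriv; case: k => [|k]; first by rewrite mul0r.
by rewrite mulr_natl.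
Qed.

(** With [D = y d/dy] one has [y^2 q'' = D (D q) - D q], which turns the equation
    into the two-term recurrence on coefficients. *)
Lemma hyp_poly_ode (R : realType) (alpha beta : R) (m : nat) : -1 < alpha ->
  let q := hyp_poly alpha beta m in
  'X * (1 - 'X) * q^`()^`() + ((alpha + 1)%:P - (alpha + beta + 2)%:P * 'X) * q^`()
    + (jacobi_eigenvalue alpha beta m)%:P * q = 0.
Proof.
move=> ha q.
have -> : 'X * (1 - 'X) * q^`()^`() + ((alpha + 1)%:P - (alpha + beta + 2)%:P * 'X) * q^`()
    + (jacobi_eigenvalue alpha beta m)%:P * q =
  'X * q^`()^`() - ('X * ('X * q^`())^`() - 'X * q^`())
  + (alpha + 1)%:P * q^`() - (alpha + beta + 2)%:P * ('X * q^`())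
  + (jacobi_eigenvalue alpha beta m)%:P * q.
  by rewrite derivM derivX; ring.
apply/polyP => k.
rewrite !(coefD, coefN, coefCM, coefX_deriv, coef_deriv, coef0) !coef_hyp_poly.
have := hyp_coefS beta m k ha; rewrite /jacobi_eigenvalue.
move: (hyp_coef _ _ _ k) (hyp_coef _ _ _ k.+1) => a0 a1.
rewrite -[a1 *+ k.+1]mulr_natl -[k.+1%:R]nat1r; move: k%:R (m%:R : R) => x y e.
apply: etrans (_ : (1 + x) * (alpha + 1 + x) * a1 -
  (x - y) * (y + alpha + beta + 1 + x) * a0 = 0); first by ring.
by rewrite e subrr.
Qed.

Lemma deriv_half_flip (R : realType) : (half_flip R)^`() = (- 2^-1)%:P.
Proof.
by rewrite /half_flip derivZ derivB derivC derivX sub0r scalerN alg_polyC polyCN.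
Qed.

(** The hypergeometric equation transported by [y = (1 - t) / 2]. *)
Lemma jacobi_ode (R : realType) (alpha beta : R) (m : nat) : -1 < alpha ->
  let p := jacobi alpha beta m in
  (1 - 'X ^+ 2) * p^`()^`() + ((beta - alpha)%:P - (alpha + beta + 2)%:P * 'X) * p^`()
    + (jacobi_eigenvalue alpha beta m)%:P * p = 0.
Proof.
move=> ha p.
have := congr1 (fun q => q \Po half_flip R) (hyp_poly_ode beta m ha) => /=.
rewrite comp_poly0 !(comp_polyB, comp_polyD, comp_polyM, comp_polyC, comp_polyX).
rewrite rmorph1 => ode.
rewrite /p jacobiE; set c := _ / _.
rewrite !derivZ !deriv_comp deriv_half_flip !derivM derivC mulr0 addr0.
rewrite deriv_comp deriv_half_flip.
set q2 := _^`()^`() \Po _ in ode *; set q1 := _^`() \Po _ in ode *.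
set q0 := hyp_poly _ _ _ \Po _ in ode *.
have hX : 'X = 1 - 2%:P * half_flip R.
  rewrite mul_polyC /half_flip scalerA mulfV ?pnatr_eq0// scale1r.
  by rewrite opprB addrC subrK.
apply: etrans (_ : c *: 0 = 0); last by rewrite scaler0.
rewrite -ode hX -!mul_polyC !(polyCB, polyCD, polyCN).
have h2 : (2^-1)%:P * 2%:P = 1 :> {poly R}.
  by rewrite -polyCM mulVf ?pnatr_eq0.
rewrite -[1%:P]/(1 : {poly R}) in h2 *.
have e2 : (2%:P : {poly R}) = 1 + 1 by rewrite -polyCD.
rewrite e2 in h2 *.
move: (half_flip R) ((2^-1)%:P) h2 q2 q1 q0 {ode hX p} => y h h2 q2 q1 q0.
(* every derivative in [t] brings a factor [h = 1/2]; inserting [2 h = 1] on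
   the other side makes both sides equal as polynomials in [h] *)
have h2M r : r = r * (h * (1 + 1)) by rewrite h2 mulr1.
rewrite [q1 in RHS]h2M [q2 in RHS]h2M [q2 in RHS]h2M.
by ring.
Qed.

(** The polynomial [T] such that, for [t = tanh x], the derivative in [x] of
    [(1-t)^a (1+t)^b s(t)] is [(1-t)^a (1+t)^b T(t)]. *)
Definition jacobi_flux (R : realType) (a b : R) (s : {poly R}) : {poly R} :=
  ((b - a)%:P - (a + b)%:P * 'X) * s + (1 - 'X ^+ 2) * s^`().

(** Lagrange's identity for the Sturm-Liouville operator: the flux of the
    Wronskian is [q] times the equation of [p] minus [p] times that of [q], up to
    the eigenvalue terms. *)
Lemma jacobi_flux_wronskian (R : realType) (alpha beta : R) (m n : nat) :
  -1 < alpha ->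
  let p := jacobi alpha beta m in let q := jacobi alpha beta n in
  jacobi_flux (alpha + 1) (beta + 1) (p^`() * q - p * q^`()) =
  (jacobi_eigenvalue alpha beta n - jacobi_eigenvalue alpha beta m) *: (p * q).
Proof.
move=> ha p q.
have := jacobi_ode beta m ha; have := jacobi_ode beta n ha; rewrite /= -/p -/q.
have -> : alpha + beta + 2 = (alpha + 1) + (beta + 1) by lra.
have -> : beta - alpha = (beta + 1) - (alpha + 1) by lra.
move: (alpha + 1) (beta + 1) => a b odeq odep.
rewrite /jacobi_flux -mul_polyC.
move: (jacobi_eigenvalue _ _ m) (jacobi_eigenvalue _ _ n) odeq odep => u v.
rewrite derivB !derivM [(v - u)%:P]polyCB.
move: ((b - a)%:P) ((a + b)%:P) (u%:P) (v%:P) => r s w z odeq odep.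
apply/eqP; rewrite -subr_eq0; apply/eqP.
apply: etrans (_ : q * 0 - p * 0 = 0); last by rewrite !mulr0 subrr.
by rewrite -{1}odep -odeq; ring.
Qed.

(** The difference of the eigenvalues is
    [(n - m) (n + m + alpha + beta + 1)], and the second factor is positive as
    soon as [n + m >= 1]. *)
Lemma jacobi_eigenvalue_inj (R : realType) (alpha beta : R) (m n : nat) :
  -1 < alpha -> -1 < beta ->
  jacobi_eigenvalue alpha beta m = jacobi_eigenvalue alpha beta n -> m = n.
Proof.
move=> ha hb; wlog mn : m n / (m <= n)%N => [hw e|].
  by case: (leqP m n) => [/hw->//|/ltnW /hw->].
move=> /eqP; rewrite eq_sym -subr_eq0 /jacobi_eigenvalue => /eqP e.
have : (n%:R - m%:R) * (n%:R + m%:R + alpha + beta + 1) = 0 :> R.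
  by rewrite -[RHS]e; ring.
move/eqP; rewrite mulf_eq0 subr_eq0 eqr_nat => /orP[/eqP//|/eqP {}e].
case: n mn e => [|n]; first by rewrite leqn0 => /eqP.
have hn : (0 : R) <= n%:R by []; have hm : (0 : R) <= m%:R by [].
rewrite -nat1r => _ e; exfalso; move: hn hm e ha hb.
move: (n%:R : R) (m%:R : R) => x y; lra.
Qed.

(** Cancelling the leading coefficient lowers the degree. *)
Lemma poly_span (R : realType) (P : nat -> {poly R}) :
  (forall m, size (P m) = m.+1) ->
  forall n (p : {poly R}), (size p <= n)%N ->
  exists c : nat -> R, p = \sum_(m < n) c m *: P m.
Proof.
move=> sP; elim=> [|n ih] p sp.
  exists (fun=> 0); rewrite big_ord0.
  by apply/eqP; rewrite -size_poly_eq0 -leqn0.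
have lP : (P n)`_n != 0.
  have := lead_coef_eq0 (P n); rewrite lead_coefE sP /= => ->.
  by rewrite -size_poly_eq0 sP.
pose d := p`_n / (P n)`_n.
have /ih[c cE] : (size (p - d *: P n)%R <= n)%N.
  apply/leq_sizeP => j; rewrite leq_eqVlt => /predU1P[<-|nj].
    by rewrite coefB coefZ /d divfK// subrr.
  rewrite coefB coefZ nth_default ?(leq_trans sp)// nth_default ?sP//.
  by rewrite mulr0 subrr.
exists (fun m => if m == n then d else c m).
rewrite big_ord_recr /= eqxx.
under eq_bigr => i _ do rewrite ltn_eqF//.
by rewrite -cE subrK.
Qed.

(** * Weierstrass approximation *)

(** The value at [x] of the de Casteljau polynomial [bernstein n g] is the mean
    of [g k] for [k] binomially distributed with parameters [n] and [x]. *)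
Fixpoint bernstein (R : realType) (n : nat) (g : nat -> R) : {poly R} :=
  if n is n'.+1 then
    'X * bernstein n' (g \o S) + (1 - 'X) * bernstein n' g
  else (g 0)%:P.

(** A quadratic bound is averaged exactly: the second moment about [c] of the
    binomial distribution is its variance [n x (1 - x)] plus [(n x - c)^2].  The
    centre [c] is arbitrary because the shift of [g] moves it to [c - 1]. *)
Lemma bernstein_approx (R : realType) (n : nat) (g : nat -> R) (h A C c x : R) :
  0 <= x <= 1 ->
  (forall k, (k <= n)%N -> `|h - g k| <= A + C * (k%:R - c) ^+ 2) ->
  `|h - (bernstein n g).[x]| <= A + C * (n%:R * (x * (1 - x)) + (n%:R * x - c) ^+ 2).
Proof.
move=> /andP[x0 x1]; elim: n g c => [|n ih] g c hg /=.
  by rewrite hornerC !mul0r add0r; exact: hg.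
have h1 := ih (g \o S) (c - 1) _.
have h0 := ih g c (fun k kn => hg k (leqW kn)).
rewrite hornerD !hornerM hornerD hornerN hornerX hornerC.
set u := (bernstein n (g \o S)).[x]; set v := (bernstein n g).[x].
have -> : h - (x * u + (1 - x) * v) = x * (h - u) + (1 - x) * (h - v) by ring.
apply: (le_trans (ler_normD _ _)).
rewrite !normrM (ger0_norm x0) (@ger0_norm _ (1 - x)) ?subr_ge0//.
have {}h1 : `|h - u| <= A + C * (n%:R * (x * (1 - x)) + (n%:R * x - (c - 1)) ^+ 2).
  apply: h1 => k kn; have := hg k.+1 kn => /= /le_trans; apply.
  by rewrite -nat1r (_ : 1 + k%:R - c = k%:R - (c - 1))//; ring.
apply: (le_trans (lerD (ler_wpM2l x0 h1) (ler_wpM2l _ h0))); first by rewrite subr_ge0.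
rewrite -nat1r le_eqVlt; apply/orP; left; apply/eqP; ring.
Qed.

(** Uniform continuity and boundedness in one inequality, in the shape that
    [bernstein_approx] averages; the constant [C] is found by compactness. *)
Lemma continuous_quadratic_modulus (R : realType) (f : R -> R) (e : R) :
  continuous f -> 0 < e ->
  exists2 C : R, 0 <= C & forall x y, 0 <= x <= 1 -> 0 <= y <= 1 ->
    `|f x - f y| <= e + C * (x - y) ^+ 2.
Proof.
move=> cf e0.
have cK : compact `[0, 1 : R]%classic by exact: segment_compact.
have [M M0 fM] : exists2 M : R, 0 < M & forall x, 0 <= x <= 1 -> `|f x| <= M.
  have : compact (f @` `[0, 1 : R]%classic).
    by apply: continuous_compact => //; exact: continuous_subspaceT.
  move=> /compact_bounded[N [_ hN]]; exists (`|N| + 1); first by rewrite ltr_pwDr.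
  move=> x x01; apply: hN; last by exists x => //=; rewrite in_itv.
  by rewrite (le_lt_trans (ler_norm _))// ltrDl.
have : \forall C \near +oo, `[0, 1]%classic `<=`
    [set x | forall y, 0 <= x <= 1 -> 0 <= y <= 1 -> `|f x - f y| <= e + C * (x - y) ^+ 2].
  move/compact_near_coveringP : cK; apply => x _.
  have /cvgrPdist_lt/(_ (e / 2)) := cf x; rewrite divr_gt0// => /(_ isT).
  move=> /nbhs_ballP[d /= d0 hd].
  have d20 : 0 < d / 2 by rewrite divr_gt0.
  (* either [y] is within [d] of [x], and the oscillation is below [e], or
     [|z - y| >= d / 2], and then [C (z - y)^2 >= 2 M] *)
  exists (ball x (d / 2), [set C | 8 * M / d ^+ 2 < C]).
    split; first exact: nbhsx_ballx.
    by apply: nbhs_pinfty_gt; rewrite num_real.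
  move=> [z C] /= [xz hC] y z01 y01.
  have C0 : 0 <= C by rewrite (le_trans _ (ltW hC))// divr_ge0 ?sqr_ge0// mulr_ge0// ltW.
  have xzd : ball x d z by apply: le_ball xz; lra.
  have sq0 : 0 <= C * (z - y) ^+ 2 by rewrite mulr_ge0 ?sqr_ge0.
  have [xyd|xyd] := ltP `|x - y| d.
    have := hd _ xzd; have := hd _ (xyd : ball x d y).
    move=> /= h1 h2; have := ler_normD (f z - f x) (f x - f y).
    rewrite addrA subrK [`|f z - f x|]distrC => h3; lra.
  have zyd : d / 2 <= `|z - y|.
    have := ler_normD (x - z) (z - y); rewrite addrA subrK.
    by move: xz; rewrite /ball /= => xz h; lra.
  have hsq : d ^+ 2 / 4 <= (z - y) ^+ 2.
    have -> : d ^+ 2 / 4 = (d / 2) ^+ 2 by rewrite expr_div_n; congr (_ / _); ring.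
    rewrite -[leRHS]real_normK ?num_real//.
    by rewrite lerXn2r// nnegrE ltW.
  have : 2 * M <= C * (z - y) ^+ 2.
    apply: le_trans (ler_wpM2l C0 hsq).
    have := ltW hC; rewrite ler_pdivrMr ?exprn_gt0// => h; lra.
  have := ler_normB (f z) (f y); have := fM _ z01; have := fM _ y01; lra.
move=> hnear.
have [C [hC C0]] := filter_ex
  (filterI hnear (nbhs_pinfty_ge (num_real (0 : R)))).
by exists C => // x y x01 y01; apply: hC => //=; rewrite in_itv.
Qed.

(** Weierstrass approximation: the Bernstein polynomials of a function with
    quadratic modulus [e + C (x - y)^2] are within [e + C / n] of it. *)
Lemma weierstrass01 (R : realType) (f : R -> R) (e : R) :
  continuous f -> 0 < e ->
  exists p : {poly R}, forall x, 0 <= x <= 1 -> `|f x - p.[x]| <= e.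
Proof.
move=> cf e0; have e20 : 0 < e / 2 by rewrite divr_gt0.
have [C C0 hC] := continuous_quadratic_modulus cf e20.
pose n := (Num.truncn (2 * C / e)).+1.
have n0 : 0 < n%:R :> R by [].
have hn : 2 * C / e < n%:R by apply: truncnS_gt.
exists (bernstein n (fun k => f (k%:R / n%:R))) => x x01.
have := @bernstein_approx R n (fun k => f (k%:R / n%:R)) (f x) (e / 2)
  (C / n%:R ^+ 2) (n%:R * x) x x01.
have nn0 : n%:R != 0 :> R by rewrite gt_eqF.
move=> h; apply: le_trans (h _) _.
  move=> k kn; apply: le_trans (hC x (k%:R / n%:R) x01 _) _.
    by rewrite divr_ge0//= ler_pdivrMr// mul1r ler_nat.
  by rewrite le_eqVlt; apply/orP; left; apply/eqP; field.
rewrite subrr expr0n addr0.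
have -> : C / n%:R ^+ 2 * (n%:R * (x * (1 - x))) = (C / n%:R) * (x * (1 - x)).
  by field.
have : C / n%:R <= e / 2.
  by move: hn; rewrite ltr_pdivrMr// ler_pdivrMr// => hn; lra.
have x1 : x * (1 - x) <= 1 by nra.
have x0 : 0 <= x * (1 - x) by move: x01 => /andP[? ?]; rewrite mulr_ge0// subr_ge0.
have Cn0 : 0 <= C / n%:R by rewrite divr_ge0// ltW.
by have := ler_wpM2l Cn0 x1; lra.
Qed.

Lemma weierstrass (R : realType) (f : R -> R) (e : R) :
  continuous f -> 0 < e ->
  exists p : {poly R}, forall t, -1 <= t <= 1 -> `|f t - p.[t]| <= e.
Proof.
move=> cf e0.
have cg : continuous (fun x : R => f (2 * x - 1)).
  move=> x; apply: continuous_comp; last exact: cf.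
  by apply: cvgB; [apply: cvgM; [exact: cvg_cst|exact: cvg_id]|exact: cvg_cst].
have [p hp] := weierstrass01 cg e0.
exists (p \Po (2^-1 *: (1 + 'X))) => t t1; rewrite horner_comp !hornerE.
have := hp (2^-1 * (1 + t)).
rewrite (_ : 2 * _ - 1 = t); last by field.
apply.
by move: t1 => /andP[? ?]; apply/andP; split; lra.
Qed.

(** * Orthonormal systems in the L2 space *)

Lemma L2P (R : realType) (f : R -> R) :
  f \in L2 R <-> measurable_fun setT f /\
    (@lebesgue_measure R).-integrable setT (EFin \o (fun x => f x ^+ 2)).
Proof.
split=> [fL|[mf /integrableP[mf2 if2]]].
  split; last exact: Lfun2_integrable_sqr.
  by move: fL; rewrite inE => /andP[]; rewrite inE.
rewrite inE; apply/andP; split; rewrite inE//= /finite_norm.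
rewrite unlock; apply: poweR_lty; apply: le_lt_trans if2.
rewrite le_eqVlt; apply/orP; left; apply/eqP; apply: eq_integral => x _ /=.
by rewrite powR_mulrn// real_normK ?num_real// ger0_norm// sqr_ge0.
Qed.

Lemma L2_mul_integrable (R : realType) (f g : R -> R) : f \in L2 R -> g \in L2 R ->
  (@lebesgue_measure R).-integrable setT (EFin \o (fun x => f x * g x)).
Proof. by move=> fL gL; apply/Lfun1_integrable; exact: Lfun2_mul_Lfun1. Qed.

Lemma L2_scale (R : realType) (c : R) (f : R -> R) :
  f \in L2 R -> (fun x => c * f x) \in L2 R.
Proof.
move=> /L2P[mf if2]; apply/L2P; split; first exact: measurable_funM.
have := integrableZl measurableT (c ^+ 2) if2; apply: eq_integrable => // x _ /=.
by rewrite exprMn EFinM.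
Qed.

Lemma L2_sub (R : realType) (f g : R -> R) :
  f \in L2 R -> g \in L2 R -> f \- g \in L2 R.
Proof.
move=> fL /(L2_scale (-1)) gL.
have h12 : (1 <= 2%:E :> \bar R)%E by rewrite lee_fin ler1n.
have [_ /(_ _ _ fL gL)] := Lfun_addr_closed (@lebesgue_measure R) h12.
rewrite (_ : f \- g = f + (fun x => -1 * g x))//.
by apply/funext => x; rewrite -[RHS]/(f x + -1 * g x) mulN1r.
Qed.

Lemma L2_sum (R : realType) (phi : nat -> R -> R) (c : nat -> R) n :
  (forall m, phi m \in L2 R) -> (fun x => \sum_(m < n) c m * phi m x) \in L2 R.
Proof.
move=> phiL; elim: n => [|n ih].
  rewrite (_ : (fun=> _) = fun x => 0 * phi 0 x); first exact: L2_scale.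
  by apply/funext => x /=; rewrite big_ord0 mul0r.
rewrite (_ : (fun=> _) = (fun x => \sum_(m < n) c m * phi m x) \- (fun x => - c n * phi n x)).
  by apply: L2_sub => //; exact: L2_scale.
by apply/funext => x /=; rewrite big_ord_recr /= mulNr opprK.
Qed.

Lemma L2dotC (R : realType) (f g : R -> R) : L2dot f g = L2dot g f.
Proof. by rewrite /L2dot; apply: eq_Rintegral => x _; rewrite mulrC. Qed.

Lemma L2dot_sub_scale (R : realType) (f g h : R -> R) (c : R) :
  f \in L2 R -> g \in L2 R -> h \in L2 R ->
  L2dot (fun x => f x - c * g x) h = L2dot f h - c * L2dot g h.
Proof.
move=> fL gL hL; rewrite /L2dot -RintegralZl//; last exact: L2_mul_integrable.
rewrite -RintegralB//; first by apply: eq_Rintegral => x _; rewrite mulrBl mulrA.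
- exact: L2_mul_integrable.
- have := L2_mul_integrable (L2_scale c gL) hL; apply: eq_integrable => // x _ /=.
  by rewrite mulrA.
Qed.

Lemma L2dist_sqrt (R : realType) (f g : R -> R) : f \in L2 R -> g \in L2 R ->
  L2dist f g = (Num.sqrt (L2dot (f \- g) (f \- g)))%:E.
Proof.
move=> fL gL; have hL := L2_sub fL gL.
have h0 : 0 <= L2dot (f \- g) (f \- g).
  by apply: Rintegral_ge0 => x _; rewrite -expr2 sqr_ge0.
rewrite /L2dist unlock -powR12_sqrt// -poweR_EFin; congr (poweR _ _).
rewrite /L2dot /Rintegral fineK; last exact/integrable_fin_num/L2_mul_integrable.
apply: eq_integral => x _ /=.
by rewrite powR_mulrn// real_normK ?num_real// expr2.
Qed.

(** Completing the square in the coefficients [c], one term at a time. *)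
Lemma orthonormal_sqdist (R : realType) (phi : nat -> R -> R) (f : R -> R)
    (c : nat -> R) n :
  orthonormal_system phi -> f \in L2 R ->
  let r := fun x => f x - \sum_(m < n) c m * phi m x in
  L2dot r r = L2dot f f - \sum_(m < n) L2dot f (phi m) ^+ 2
              + \sum_(m < n) (c m - L2dot f (phi m)) ^+ 2.
Proof.
move=> [phiL phi1] fL /=; elim: n => [|n ih].
  rewrite !big_ord0 subr0 addr0; congr (L2dot _ _);
    by apply/funext => x; rewrite big_ord0 subr0.
pose r k x := f x - \sum_(m < k) c m * phi m x.
have rL k : r k \in L2 R by exact: (L2_sub fL (L2_sum c k phiL)).
have rS : r n.+1 = fun x => r n x - c n * phi n x.
  by apply/funext => x; rewrite /r big_ord_recr /= opprD addrA.
(* the residue keeps the Fourier coefficients of index at least [n] *)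
have rphi k l : (k <= l)%N -> L2dot (r k) (phi l) = L2dot f (phi l).
  elim: k => [|k ihk] kl.
    by congr (L2dot _ _); apply/funext => x; rewrite /r big_ord0 subr0.
  have -> : r k.+1 = fun x => r k x - c k * phi k x.
    by apply/funext => x; rewrite /r big_ord_recr /= opprD addrA.
  by rewrite L2dot_sub_scale// phi1 (ltn_eqF kl) mulr0 subr0 ihk// ltnW.
have phir : L2dot (phi n) (r n) = L2dot f (phi n) by rewrite L2dotC rphi.
rewrite -/(r n.+1) rS L2dot_sub_scale//; last by rewrite -rS.
rewrite (L2dotC (r n)) (L2dotC (phi n)) !L2dot_sub_scale//.
rewrite [L2dot (r n) (r n)]ih !phi1 eqxx phir rphi// !big_ord_recr /=; ring.
Qed.

(** In [orthonormal_sqdist] the last sum vanishes for the Fourier coefficients,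
    and the middle one increases with the number of terms. *)
Lemma fourier_sum_best (R : realType) (phi : nat -> R -> R) (f : R -> R)
    (c : nat -> R) n N : (n <= N)%N ->
  orthonormal_system phi -> f \in L2 R ->
  (L2dist f (fun x => \sum_(m < N) L2dot f (phi m) * phi m x)%R <=
   L2dist f (fun x => \sum_(m < n) c m * phi m x)%R)%E.
Proof.
move=> nN phi1 fL; have phiL := phi1.1.
rewrite (L2dist_sqrt fL (L2_sum (fun m => L2dot f (phi m)) N phiL)) (L2dist_sqrt fL (L2_sum c n phiL)).
rewrite lee_fin ler_sqrt; last first.
  by apply: Rintegral_ge0 => x _; rewrite -expr2 sqr_ge0.
rewrite [leLHS](orthonormal_sqdist (fun m => L2dot f (phi m)) N phi1 fL).
rewrite [leRHS](orthonormal_sqdist c n phi1 fL).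
rewrite [X in _ + X <= _]big1; last by move=> i _; rewrite subrr expr0n.
rewrite addr0.
have c0 : 0 <= \sum_(m < n) (c m - L2dot f (phi m)) ^+ 2.
  by apply: sumr_ge0 => m _; exact: sqr_ge0.
suff : \sum_(m < n) L2dot f (phi m) ^+ 2 <= \sum_(m < N) L2dot f (phi m) ^+ 2 by lra.
rewrite (big_ord_widen N (fun m => L2dot f (phi m) ^+ 2))//.
rewrite [leRHS](bigID (fun m : 'I_N => (m < n)%N)) /= lerDl.
by apply: sumr_ge0 => m _; exact: sqr_ge0.
Qed.

Lemma orthonormal_complete_basis (R : realType) (phi : nat -> R -> R) :
  orthonormal_system phi -> complete_system phi -> orthonormal_basis phi.
Proof.
move=> phi1 phic; split=> // f fL.
have sL n := L2_sum (fun m => L2dot f (phi m)) n phi1.1.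
apply/fine_cvgP; split; first by near=> n; rewrite L2dist_sqrt.
apply/cvgr0Pnorm_lt => e e0; have [n [c hc]] := phic f fL e e0.
exists n => // N /= nN; rewrite -lte_fin.
apply: le_lt_trans hc; apply: le_trans (fourier_sum_best c nN phi1 fL).
by rewrite /= (L2dist_sqrt fL (sL N)) /= ger0_norm ?sqrtr_ge0.
Unshelve. all: by end_near. Qed.

(** * The hyperbolic tangent and the Jacobi weight *)

Lemma cosh_gt0 (R : realType) (x : R) : 0 < expR x + expR (- x).
Proof. by rewrite addr_gt0 ?expR_gt0. Qed.

Lemma one_sub_tanhE (R : realType) (x : R) :
  1 - tanh x = 2 * expR (- x) / (expR x + expR (- x)).
Proof. by rewrite /tanh; have := cosh_gt0 x; move=> h; field; rewrite gt_eqF. Qed.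

Lemma one_add_tanhE (R : realType) (x : R) :
  1 + tanh x = 2 * expR x / (expR x + expR (- x)).
Proof. by rewrite /tanh; have := cosh_gt0 x; move=> h; field; rewrite gt_eqF. Qed.

Lemma tanhN (R : realType) (x : R) : tanh (- x) = - tanh x.
Proof. by rewrite /tanh opprK -mulNr opprB (addrC (expR (- x)) (expR x)). Qed.

Lemma one_sub_tanh_gt0 (R : realType) (x : R) : 0 < 1 - tanh x.
Proof. by rewrite one_sub_tanhE divr_gt0 ?cosh_gt0 ?mulr_gt0 ?expR_gt0. Qed.

Lemma one_add_tanh_gt0 (R : realType) (x : R) : 0 < 1 + tanh x.
Proof. by rewrite one_add_tanhE divr_gt0 ?cosh_gt0 ?mulr_gt0 ?expR_gt0. Qed.

Lemma tanh_itv (R : realType) (x : R) : -1 <= tanh x <= 1.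
Proof.
have := one_sub_tanh_gt0 x; have := one_add_tanh_gt0 x => ? ?.
by apply/andP; split; lra.
Qed.

Lemma one_sub_tanh_le (R : realType) (x : R) : 1 - tanh x <= 2 * expR (- x).
Proof.
rewrite one_sub_tanhE ler_pdivrMr ?cosh_gt0// ler_peMr ?mulr_ge0 ?expR_ge0//.
have [x0|/ltW x0] := leP 0 x.
- have : 1 <= expR x by rewrite -expR0 ler_expR.
  by have := expR_ge0 (- x); lra.
- have : 1 <= expR (- x) by rewrite -expR0 ler_expR oppr_ge0.
  by have := expR_ge0 x; lra.
Qed.

#[local] Instance is_derive_tanh (R : realType) (x : R) :
  is_derive x 1 (@tanh R) (1 - tanh x ^+ 2).
Proof.
have h := cosh_gt0 x.
have hN : is_derive x 1 (fun y : R => expR (- y)) (- expR (- x)).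
  have := @is_derive1_comp R expR -%R x _ _ (is_derive_expR (- x)) (is_deriveNid x 1).
  by rewrite mulrN1.
have hV : is_derive x 1 (fun y : R => (expR y + expR (- y))^-1)
    (- (expR x + expR (- x)) ^- 2 *: (expR x + - expR (- x))).
  by apply: is_deriveV; rewrite ?gt_eqF//.
have := @is_deriveM R R (fun y : R => expR y - expR (- y)) _ x 1 _ _ _ hV.
move=> /(_ _ _)/is_derive_eq; apply.
rewrite /tanh /GRing.scale /=; field; exact: lt0r_neq0.
Qed.

Lemma continuous_tanh (R : realType) : continuous (@tanh R).
Proof. by move=> x; apply/differentiable_continuous/derivable1_diffP. Qed.

Lemma ltr_tanh (R : realType) : {homo @tanh R : x y / x < y}.
Proof.
move=> x y xy; rewrite /tanh ltr_pdivrMr ?cosh_gt0// mulrAC ltr_pdivlMr ?cosh_gt0//.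
rewrite -subr_gt0.
have : 0 < 2 * (expR y * expR (- x) - expR x * expR (- y)).
  by rewrite mulr_gt0// -!expRD subr_gt0 ltr_expR; lra.
lra.
Qed.

(** For [a = alpha + 1] and [b = beta + 1] this is the Jacobi weight times the
    Jacobian [1 - tanh^2] of the substitution. *)
Definition tanh_weight (R : realType) (a b x : R) : R :=
  (1 - tanh x) `^ a * (1 + tanh x) `^ b.

Lemma tanh_weight_gt0 (R : realType) (a b x : R) : 0 < tanh_weight a b x.
Proof.
by rewrite /tanh_weight mulr_gt0 ?powR_gt0 ?one_sub_tanh_gt0 ?one_add_tanh_gt0.
Qed.

Lemma tanh_weight_ge0 (R : realType) (a b x : R) : 0 <= tanh_weight a b x.
Proof. exact/ltW/tanh_weight_gt0. Qed.

Lemma is_derive_tanh_weight (R : realType) (a b x : R) :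
  is_derive x 1 (tanh_weight a b)
    (tanh_weight a b x * ((b - a) - (a + b) * tanh x)).
Proof.
have hu := one_sub_tanh_gt0 x; have hv := one_add_tanh_gt0 x.
have powRB1 (c u : R) : 0 < u -> u `^ c = u `^ (c - 1) * u.
  move=> u0; rewrite -[X in _ * X]powRr1 ?ltW// -powRD ?subrK//.
  by apply/implyP => _; rewrite gt_eqF.
have du : is_derive x 1 (fun y : R => 1 - tanh y) (- (1 - tanh x ^+ 2)).
  have := is_deriveB (is_derive_cst (1 : R) x 1) (is_derive_tanh x).
  by rewrite sub0r.
have dv : is_derive x 1 (fun y : R => 1 + tanh y) (1 - tanh x ^+ 2).
  have := is_deriveD (is_derive_cst (1 : R) x 1) (is_derive_tanh x).
  by rewrite add0r.
have dua := @is_derive1_comp R (@powR R ^~ a) (fun y => 1 - tanh y) x _ _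
  (is_derive1_powR a hu) du.
have dvb := @is_derive1_comp R (@powR R ^~ b) (fun y => 1 + tanh y) x _ _
  (is_derive1_powR b hv) dv.
apply: is_derive_eq (is_deriveM dua dvb) _.
rewrite /tanh_weight /GRing.scale /= (powRB1 a _ hu) (powRB1 b _ hv); ring.
Qed.

Lemma is_derive_flux (R : realType) (a b x : R) (s : {poly R}) :
  is_derive x 1 (fun y => tanh_weight a b y * s.[tanh y])
    (tanh_weight a b x * (jacobi_flux a b s).[tanh x]).
Proof.
have ds := @is_derive1_comp R (horner s) (@tanh R) x _ _
  (is_derive_poly s (tanh x)) (is_derive_tanh x).
apply: is_derive_eq (is_deriveM (is_derive_tanh_weight a b x) ds) _.
rewrite /jacobi_flux /GRing.scale /=.
rewrite !(hornerD, hornerN, hornerM, hornerC, hornerX).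
by move: (tanh_weight a b x) (tanh x) => w t; ring.
Qed.

Lemma continuous_tanh_weight_poly (R : realType) (a b : R) (s : {poly R}) :
  continuous (fun x => tanh_weight a b x * s.[tanh x]).
Proof.
move=> x; apply/differentiable_continuous/derivable1_diffP.
by have [] := is_derive_flux a b x s.
Qed.

Lemma continuous_tanh_weight (R : realType) (a b : R) :
  continuous (@tanh_weight R a b).
Proof.
move=> x; apply/differentiable_continuous/derivable1_diffP.
by have [] := is_derive_tanh_weight a b x.
Qed.

(** * Integrals over the line by exhaustion *)

Definition sym_itv (R : realType) (n : nat) : set R := `[- n.+1%:R, n.+1%:R].
Arguments sym_itv R n : clear implicits.

Lemma bigcup_sym_itv (R : realType) :
  \bigcup_n @sym_itv R n = setT.
Proof.
apply/seteqP; split=> // x _; exists (Num.truncn `|x|) => //=.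
by rewrite /sym_itv /= in_itv /= -ler_norml ltW// truncnS_gt.
Qed.

Lemma nondecreasing_sym_itv (R : realType) :
  nondecreasing_seq (@sym_itv R).
Proof.
move=> m n mn; rewrite subsetEset /sym_itv => x /=; rewrite !in_itv /= => /andP[h1 h2].
have : (m.+1%:R : R) <= n.+1%:R by rewrite ler_nat.
by move=> h; apply/andP; split; lra.
Qed.

Lemma FTC_sym_itv (R : realType) (F f : R -> R) (n : nat) :
  (forall x : R, is_derive x 1 F (f x)) -> continuous f ->
  (\int[@lebesgue_measure R]_(x in sym_itv R n) (f x)%:E =
   (F n.+1%:R - F (- n.+1%:R))%R%:E)%E.
Proof.
move=> dF cf; have cF : continuous F.
  by move=> x; apply/differentiable_continuous/derivable1_diffP; have [] := dF x.
rewrite (@continuous_FTC2 _ f F) ?EFinB//.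
- by have : (0 : R) < n.+1%:R by []; lra.
- exact: continuous_subspaceT.
- split=> [x _||]; first by have [] := dF x.
  + exact/cvg_at_right_filter/cF.
  + exact/cvg_at_left_filter/cF.
- by move=> x _; rewrite derive1E; have [] := dF x.
Qed.

(** The integrals of [f] over the exhausting intervals are increments of [F],
    hence at most [2 M]. *)
Lemma integrable_bounded_primitive (R : realType) (F f : R -> R) (M : R) :
  (forall x : R, is_derive x 1 F (f x)) -> continuous f ->
  (forall x, 0 <= f x) -> (forall x, `|F x| <= M) ->
  (@lebesgue_measure R).-integrable setT (EFin \o f).
Proof.
move=> dF cf f0 FM.
have mf : measurable_fun setT (EFin \o f).
  by apply/measurable_EFinP; exact: continuous_measurable_fun.
apply/integrableP; split => //.
under eq_integral do rewrite gee0_abs ?lee_fin//.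
apply: (@le_lt_trans _ _ (2 * M)%:E); last exact: ltry.
have h : (\int[@lebesgue_measure R]_(x in sym_itv R n) (f x)%:E
    @[n --> \oo] --> \int[@lebesgue_measure R]_x (f x)%:E)%E.
  rewrite -(bigcup_sym_itv R).
  apply: ge0_nondecreasing_set_cvg_integral; first exact: nondecreasing_sym_itv.
  - by move=> n; exact: measurable_itv.
  - by move=> n; exact: measurable_funTS.
  - by move=> n x _; rewrite lee_fin.
rewrite -(cvg_lim _ h)//; apply: lime_le; first by apply/cvg_ex; eexists; exact: h.
apply: nearW => n; rewrite (FTC_sym_itv _ dF cf) lee_fin.
have := FM n.+1%:R; have := FM (- n.+1%:R).
by rewrite !ler_norml => /andP[? ?] /andP[? ?]; lra.
Qed.

Lemma cvg_integral_sym_itv (R : realType) (f : R -> R) :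
  (@lebesgue_measure R).-integrable setT (EFin \o f) ->
  (\int[@lebesgue_measure R]_(x in sym_itv R n) (f x)%:E
     @[n --> \oo] --> \int[@lebesgue_measure R]_x (f x)%:E)%E.
Proof.
move=> intf.
under eq_fun do rewrite integral_mkcond.
apply: (@dominated_cvg _ _ _ (@lebesgue_measure R) setT measurableT _ _
  (fun x => `|f x|%:E)).
- move=> n.
  apply/(measurable_restrictT (EFin \o f)); first exact: measurable_itv.
  by apply: measurable_funTS; case/integrableP: intf.
- move=> x _; apply: cvg_near_cst; exists (Num.truncn `|x|) => // n /= nx.
  rewrite patchE mem_set// /sym_itv /= in_itv /= -ler_norml.
  by rewrite ltW// (lt_le_trans (truncnS_gt _))// ler_nat.
- by [].
- exact: integrable_norm.
- move=> n x _; rewrite patchE; case: ifP => _; first by rewrite abse_EFin.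
  by rewrite abse0 lee_fin.
Qed.

Lemma Rintegral_primitive (R : realType) (F f : R -> R) (l l' : R) :
  (forall x : R, is_derive x 1 F (f x)) -> continuous f ->
  (@lebesgue_measure R).-integrable setT (EFin \o f) ->
  F n.+1%:R @[n --> \oo] --> l -> F (- n.+1%:R) @[n --> \oo] --> l' ->
  \int[@lebesgue_measure R]_x f x = l - l'.
Proof.
move=> dF cf intf Fl Fl'.
have := cvg_integral_sym_itv intf.
under eq_fun do rewrite (FTC_sym_itv _ dF cf).
move=> h1.
have h2 : ((F n.+1%:R - F (- n.+1%:R))%R%:E @[n --> \oo] --> (l - l')%:E)%E.
  by apply: cvg_EFin; [exact: nearW|exact: cvgB].
by rewrite /Rintegral -(cvg_unique _ h2 h1).
Qed.

(** * Integrability and orthogonality *)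

Lemma poly_bounded (R : realType) (p : {poly R}) :
  exists2 M : R, 0 <= M & forall t, -1 <= t <= 1 -> `|p.[t]| <= M.
Proof.
exists (\sum_(i < size p) `|p`_i|); first exact: sumr_ge0.
move=> t t1; rewrite horner_coef; apply: le_trans (ler_norm_sum _ _ _) _.
apply: ler_sum => i _; rewrite normrM ler_piMr// normrX exprn_ile1//.
by rewrite ler_norml.
Qed.

Lemma tanh_weight_le (R : realType) (a b x : R) : 0 <= a -> 0 <= b ->
  tanh_weight a b x <= (1 - tanh x) `^ a * 2 `^ b.
Proof.
move=> a0 b0; rewrite /tanh_weight ler_wpM2l ?powR_ge0//.
have := one_sub_tanh_gt0 x; have := one_add_tanh_gt0 x => h1 h2.
by apply: ge0_ler_powR => //; rewrite ?nnegrE ?ltW//; lra.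
Qed.

Lemma tanh_weightN (R : realType) (a b x : R) :
  tanh_weight a b (- x) = tanh_weight b a x.
Proof. by rewrite /tanh_weight tanhN opprK mulrC. Qed.

Lemma cvg_one_sub_tanh (R : realType) :
  1 - tanh (n.+1%:R : R) @[n --> \oo] --> (0 : R).
Proof.
have h0 : expR (- (n.+1%:R : R)) @[n --> \oo] --> (0 : R).
  have /cvg_comp := @cvgr_idn R; move=> /(_ _ _ _ (@cvgr_expR R)).
  by rewrite -cvg_shiftS.
apply: (@squeeze_cvgr _ _ _ _ (cst 0) (fun n => 2 * expR (- (n.+1%:R : R)))).
- apply: nearW => n /=; apply/andP; split; last exact: one_sub_tanh_le.
  exact/ltW/one_sub_tanh_gt0.
- exact: cvg_cst.
- by rewrite -[X in _ --> X](mulr0 2); apply: cvgMr.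
Qed.

Lemma cvg_tanh_weight (R : realType) (a b : R) : 0 < a -> 0 <= b ->
  tanh_weight a b n.+1%:R @[n --> \oo] --> (0 : R).
Proof.
move=> a0 b0.
have h : (1 - tanh (n.+1%:R : R)) `^ a * 2 `^ b @[n --> \oo] --> (0 : R).
  rewrite -(mul0r (2 `^ b)); apply: cvgMl.
  have /cvg_at_rightP := powR_cvg0 a0; apply; split; last exact: cvg_one_sub_tanh.
  by move=> n; exact: one_sub_tanh_gt0.
apply: (@squeeze_cvgr _ _ _ _ (cst 0)) h; last exact: cvg_cst.
by apply: nearW => n; rewrite /= tanh_weight_ge0/= tanh_weight_le// ltW.
Qed.

Lemma cvg_tanh_weight_poly (R : realType) (a b : R) (s : {poly R}) (u : nat -> R) :
  tanh_weight a b (u n) @[n --> \oo] --> (0 : R) ->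
  tanh_weight a b (u n) * s.[tanh (u n)] @[n --> \oo] --> (0 : R).
Proof.
move=> h; have [M M0 hM] := poly_bounded s.
apply/norm_cvg0P.
apply: (@squeeze_cvgr _ _ _ _ (cst 0) (fun n => tanh_weight a b (u n) * M)).
- apply: nearW => n /=; rewrite normr_ge0 normrM ger0_norm ?tanh_weight_ge0//=.
  by rewrite ler_wpM2l ?hM ?tanh_itv ?tanh_weight_ge0.
- exact: cvg_cst.
by rewrite -(mul0r M); apply: cvgMl.
Qed.

(** With [t = tanh x], the derivative in [x] of the bounded function
    [(1+t)^b - (1-t)^a] decays at both ends like the weight, and a multiple of it
    dominates the weight. *)
Lemma integrable_tanh_weight (R : realType) (a b : R) : 0 < a -> 0 < b ->
  (@lebesgue_measure R).-integrable setT (EFin \o tanh_weight a b).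
Proof.
move=> a0 b0.
pose h x : R := tanh_weight 0 b x * (b - b * tanh x) +
                tanh_weight a 0 x * (a + a * tanh x).
pose H x : R := tanh_weight 0 b x - tanh_weight a 0 x.
have Wab (x : R) : ((tanh_weight 0 b x = (1 + tanh x) `^ b) *
    (tanh_weight a 0 x = (1 - tanh x) `^ a))%type.
  by split; rewrite /tanh_weight powRr0 ?mul1r ?mulr1.
have dH (x : R) : is_derive x 1 H (h x).
  apply: is_derive_eq
    (is_deriveB (is_derive_tanh_weight 0 b x) (is_derive_tanh_weight a 0 x)) _.
  by rewrite /h; ring.
have ch : continuous h.
  move=> x; apply: cvgD; apply: cvgM; try exact: continuous_tanh_weight.
    by apply: cvgB; [exact: cvg_cst|apply: cvgMr; exact: continuous_tanh].
  by apply: cvgD; [exact: cvg_cst|apply: cvgMr; exact: continuous_tanh].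
have h1 (x : R) : 0 < 1 - tanh x < 2 /\ 0 < 1 + tanh x < 2.
  have := one_sub_tanh_gt0 x; have := one_add_tanh_gt0 x => ? ?.
  by split; apply/andP; split; lra.
have hpos x : 0 <= h x.
  have [/andP[? ?] /andP[? ?]] := h1 x.
  rewrite /h addr_ge0// mulr_ge0 ?tanh_weight_ge0// ltW//.
    by rewrite -{1}(mulr1 b) -mulrBr mulr_gt0.
  by rewrite -{1}(mulr1 a) -mulrDr mulr_gt0.
have pow2 (c u : R) : 0 < c -> 0 < u < 2 -> 0 <= u `^ c <= 2 `^ c.
  move=> c0 /andP[u0 u2]; rewrite powR_ge0/=.
  by apply: ge0_ler_powR; rewrite ?nnegrE ?ltW.
have inth : (@lebesgue_measure R).-integrable setT (EFin \o h).
  apply: (@integrable_bounded_primitive _ H h (2 `^ a + 2 `^ b)) => // x.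
  have [/(pow2 _ _ a0)/andP[? ?] /(pow2 _ _ b0)/andP[? ?]] := h1 x.
  by rewrite /H !Wab ler_norml; apply/andP; split; lra.
pose C := 2 `^ b / a + 2 `^ a / b.
apply: le_integrable (integrableZl measurableT C inth) => //.
  apply/measurable_EFinP; apply: continuous_measurable_fun.
  exact: continuous_tanh_weight.
move=> x _; rewrite lee_fin ger0_norm ?tanh_weight_ge0//.
apply: le_trans (ler_norm _).
have [/[dup]/andP[s0 s2]/(pow2 _ _ a0)/andP[u0 uA]] := h1 x.
move=> /[dup]/andP[r0 r2]/(pow2 _ _ b0)/andP[v0 vB].
rewrite /= /C /h !Wab /tanh_weight.
move: (2 `^ a) (2 `^ b) ((1 - tanh x) `^ a) ((1 + tanh x) `^ b) u0 uA v0 vB.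
move=> A B u v u0 uA v0 vB.
have A0 : 0 <= A := le_trans u0 uA; have B0 : 0 <= B := le_trans v0 vB.
have Ba0 : 0 <= B / a by rewrite divr_ge0// ltW.
have Ab0 : 0 <= A / b by rewrite divr_ge0// ltW.
have BaE : B / a * (u * a) = B * u by field; rewrite gt_eqF.
have AbE : A / b * (v * b) = A * v by field; rewrite gt_eqF.
have C1 : B / a <= B / a + A / b by rewrite lerDl.
have C2 : A / b <= B / a + A / b by rewrite lerDr.
have v1 : 0 <= v * (b - b * tanh x).
  by rewrite -{1}(mulr1 b) -mulrBr !mulr_ge0// ltW.
have u1 : 0 <= u * (a + a * tanh x).
  by rewrite -{1}(mulr1 a) -mulrDr !mulr_ge0// ltW.
have [t0|/ltW t0] := leP 0 (tanh x).
(* for [t >= 0] the factor [v] is at most [B] and [1 + t >= 1], so the second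
   term of [h] suffices; for [t <= 0] the first one does *)
- apply: (@le_trans _ _ (B / a * (u * a))).
    by rewrite BaE mulrC ler_wpM2r.
  apply: ler_pM => //; first by rewrite mulr_ge0// ltW.
  apply: (@le_trans _ _ (u * (a + a * tanh x))); last by rewrite lerDr.
  by rewrite ler_wpM2l// lerDl mulr_ge0// ltW.
- apply: (@le_trans _ _ (A / b * (v * b))).
    by rewrite AbE ler_wpM2r.
  apply: ler_pM => //; first by rewrite mulr_ge0// ltW.
  apply: (@le_trans _ _ (v * (b - b * tanh x))); last by rewrite lerDl.
  by rewrite ler_wpM2l// lerDl oppr_ge0 mulr_ge0_le0// ltW.
Qed.

Lemma integrable_tanh_weight_poly (R : realType) (a b : R) (s : {poly R}) :
  0 < a -> 0 < b ->
  (@lebesgue_measure R).-integrable setT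
    (EFin \o (fun x => tanh_weight a b x * s.[tanh x])).
Proof.
move=> a0 b0; have [M M0 hM] := poly_bounded s.
apply: le_integrable (integrableZl measurableT M (integrable_tanh_weight a0 b0)) => //.
  apply/measurable_EFinP; apply: continuous_measurable_fun.
  exact: continuous_tanh_weight_poly.
move=> x _; rewrite lee_fin normrM mulrC normrM.
by rewrite ler_wpM2r// (le_trans (hM _ (tanh_itv x)))// ler_norm.
Qed.

(** The integrand is the derivative of [W s(tanh x)], which tends to 0 at both
    ends because both exponents are positive. *)
Lemma Rintegral_flux (R : realType) (a b : R) (s : {poly R}) : 0 < a -> 0 < b ->
  \int[@lebesgue_measure R]_x (tanh_weight a b x * (jacobi_flux a b s).[tanh x]) = 0.
Proof.
move=> a0 b0; rewrite -[RHS](subr0 0).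
apply: (Rintegral_primitive (fun x => is_derive_flux a b x s)).
- exact: continuous_tanh_weight_poly.
- exact: integrable_tanh_weight_poly.
- by apply: cvg_tanh_weight_poly; apply: cvg_tanh_weight => //; exact: ltW.
- apply: cvg_tanh_weight_poly; under eq_fun do rewrite tanh_weightN.
  by apply: cvg_tanh_weight => //; exact: ltW.
Qed.

Lemma jacobi_orthogonal (R : realType) (alpha beta : R) (m n : nat) :
  -1 < alpha -> -1 < beta -> m != n ->
  \int[@lebesgue_measure R]_x (tanh_weight (alpha + 1) (beta + 1) x *
     (jacobi alpha beta m * jacobi alpha beta n).[tanh x]) = 0.
Proof.
move=> ha hb mn; have a0 : 0 < alpha + 1 by lra. have b0 : 0 < beta + 1 by lra.
pose p := jacobi alpha beta m; pose q := jacobi alpha beta n.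
have := Rintegral_flux (p^`() * q - p * q^`()) a0 b0.
rewrite jacobi_flux_wronskian//.
under eq_Rintegral do rewrite hornerZ mulrCA.
rewrite RintegralZl//; last exact: integrable_tanh_weight_poly.
move/eqP; rewrite mulf_eq0 => /orP[|/eqP//]; rewrite subr_eq0 => /eqP e.
by move: mn; rewrite (jacobi_eigenvalue_inj ha hb (esym e)) eqxx.
Qed.

(** * The change of variable to the interval *)

Lemma bigcup_tanh_itv (R : realType) :
  \bigcup_n `[tanh (- n.+1%:R : R), tanh n.+1%:R]%classic = `]-1, 1[%classic.
Proof.
apply/seteqP; split=> [t [n _ /=]|t /=]; rewrite !in_itv /=.
  have := one_sub_tanh_gt0 (n.+1%:R : R); have := one_add_tanh_gt0 (- n.+1%:R : R).
  by move=> ? ? /andP[? ?]; apply/andP; split; lra.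
move=> /andP[t1 t2].
have e0 : 0 < Num.min (1 - t) (1 + t) by rewrite lt_min; apply/andP; split; lra.
have /cvgr0Pnorm_lt/(_ _ e0)[n _ /(_ n (leqnn n))] := @cvg_one_sub_tanh R.
rewrite /= gtr0_norm ?one_sub_tanh_gt0// lt_min => /andP[h1 h2].
by exists n => //=; rewrite in_itv /= tanhN; apply/andP; split; lra.
Qed.

Definition jacobi_weighted (R : realType) (alpha beta : R) (p : {poly R}) (t : R) : R :=
  (1 - t) `^ alpha * (1 + t) `^ beta * p.[t].

Lemma measurable_jacobi_weight (R : realType) (alpha beta : R) (p : {poly R}) :
  measurable_fun setT (jacobi_weighted alpha beta p).
Proof.
apply: measurable_funM; last by apply: continuous_measurable_fun; exact: continuous_horner.
apply: measurable_funM.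
- by apply: (measurableT_comp (measurable_powR alpha)); exact: measurable_funB.
- by apply: (measurableT_comp (measurable_powR beta)); exact: measurable_funD.
Qed.

Lemma continuous_jacobi_weight (R : realType) (alpha beta : R) (p : {poly R}) t :
  -1 < t < 1 -> {for t, continuous (jacobi_weighted alpha beta p)}.
Proof.
move=> /andP[t1 t2].
have hpow (c u : R) : 0 < u -> {for u, continuous (@powR R ^~ c)}.
  move=> u0; apply/differentiable_continuous/derivable1_diffP.
  by have [] := is_derive1_powR c u0.
have cl : {for t, continuous ((@powR R ^~ alpha) \o (fun y => 1 - y))}.
  apply: continuous_comp; last by apply: hpow; lra.
  by apply: cvgB; [exact: cvg_cst|exact: cvg_id].
have cr : {for t, continuous ((@powR R ^~ beta) \o (fun y => 1 + y))}.
  apply: continuous_comp; last by apply: hpow; lra.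
  by apply: cvgD; [exact: cvg_cst|exact: cvg_id].
by apply: cvgM; [exact: cvgM|exact: continuous_horner].
Qed.

Lemma jacobi_weight_tanh (R : realType) (alpha beta : R) (p : {poly R}) (x : R) :
  jacobi_weighted alpha beta p (tanh x) * (1 - tanh x ^+ 2) =
  tanh_weight (alpha + 1) (beta + 1) x * p.[tanh x].
Proof.
have hu := one_sub_tanh_gt0 x; have hv := one_add_tanh_gt0 x.
rewrite /jacobi_weighted /tanh_weight !powRD ?powRr1 ?ltW//; first by ring.
- by apply/implyP => _; rewrite gt_eqF.
- by apply/implyP => _; rewrite gt_eqF.
Qed.

Lemma derive1_tanh (R : realType) : derive1 (@tanh R) = fun x => 1 - tanh x ^+ 2.
Proof. by apply/funext => x; rewrite derive1E; have [] := is_derive_tanh x. Qed.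

Lemma integral_tanh_sym_itv (R : realType) (alpha beta : R) (p : {poly R}) n :
  (\int[@lebesgue_measure R]_(t in `[tanh (- n.+1%:R)%R, tanh n.+1%:R%R])
     (jacobi_weighted alpha beta p t)%:E =
   \int[@lebesgue_measure R]_(x in sym_itv R n)
     (tanh_weight (alpha + 1) (beta + 1) x * p.[tanh x])%:E)%E.
Proof.
have cd : continuous (derive1 (@tanh R)).
  rewrite derive1_tanh => x; apply: cvgB; first exact: cvg_cst.
  by rewrite expr2; apply: cvgM; exact: continuous_tanh.
rewrite integration_by_substitution_increasing.
- by apply: eq_integral => x _; rewrite derive1_tanh -jacobi_weight_tanh.
- by have : (0 : R) <= n.+1%:R by []; lra.
- by move=> x y _ _; exact: ltr_tanh.
- by move=> x _; exact: cd.
- by apply/cvg_ex; eexists; exact/cvg_at_right_filter/cd.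
- by apply/cvg_ex; eexists; exact/cvg_at_left_filter/cd.
- split=> [x _||]; first by have [] := is_derive_tanh x.
  + exact/cvg_at_right_filter/continuous_tanh.
  + exact/cvg_at_left_filter/continuous_tanh.
- apply: continuous_in_subspaceT => t; rewrite inE /= in_itv /= => /andP[h1 h2].
  apply: continuous_jacobi_weight.
  have := one_sub_tanh_gt0 (n.+1%:R : R); have := one_add_tanh_gt0 (- n.+1%:R : R).
  by move=> ? ?; apply/andP; split; lra.
Qed.

(** The weight may be singular at the endpoints, so the substitution is made on
    the intervals [[tanh (-n), tanh n]], where it is continuous, followed by
    monotone convergence on both sides. *)
Lemma integral_jacobi_weight (R : realType) (alpha beta : R) (p : {poly R}) :
  (forall t, 0 <= p.[t]) ->
  (\int[@lebesgue_measure R]_(t in `[(-1)%R, 1%R]) (jacobi_weighted alpha beta p t)%:E =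
   \int[@lebesgue_measure R]_x
     (tanh_weight (alpha + 1) (beta + 1) x * p.[tanh x])%:E)%E.
Proof.
move=> p0.
rewrite integral_itv_bndoo; last first.
  by apply/measurable_EFinP; apply: measurable_funTS; exact: measurable_jacobi_weight.
have h1 : (\int[@lebesgue_measure R]_(t in `[tanh (- n.+1%:R)%R, tanh n.+1%:R%R])
     (jacobi_weighted alpha beta p t)%:E @[n --> \oo] -->
   \int[@lebesgue_measure R]_(t in `](-1)%R, 1%R[) (jacobi_weighted alpha beta p t)%:E)%E.
  rewrite -(bigcup_tanh_itv R).
  apply: ge0_nondecreasing_set_cvg_integral.
  - move=> m n mn; rewrite subsetEset => x /=; rewrite !in_itv /= => /andP[h1 h2].
    have mn' : (m.+1%:R : R) <= n.+1%:R by rewrite ler_nat.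
    have ht : tanh (m.+1%:R : R) <= tanh (n.+1%:R : R).
      exact: (ltW_homo (@ltr_tanh R)).
    by move: h1; rewrite !tanhN => h1; apply/andP; split; lra.
  - by move=> n; exact: measurable_itv.
  - move=> n; apply/measurable_EFinP; apply: measurable_funTS.
    exact: measurable_jacobi_weight.
  - by move=> n x _; rewrite lee_fin !mulr_ge0 ?powR_ge0.
have h2 : (\int[@lebesgue_measure R]_(x in sym_itv R n)
     (tanh_weight (alpha + 1) (beta + 1) x * p.[tanh x])%:E @[n --> \oo] -->
   \int[@lebesgue_measure R]_x
     (tanh_weight (alpha + 1) (beta + 1) x * p.[tanh x])%:E)%E.
  rewrite -(bigcup_sym_itv R).
  apply: ge0_nondecreasing_set_cvg_integral; first exact: nondecreasing_sym_itv.
  - by move=> n; exact: measurable_itv.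
  - move=> n; apply/measurable_EFinP; apply: measurable_funTS.
    by apply: continuous_measurable_fun; exact: continuous_tanh_weight_poly.
  - by move=> n x _; rewrite lee_fin mulr_ge0 ?tanh_weight_ge0.
move: h1; under eq_fun do rewrite integral_tanh_sym_itv.
by move=> h1; exact: cvg_unique h1 h2.
Qed.

(** * Normalisation *)

Lemma integral_continuous_gt0 (R : realType) (g : R -> R) (x0 : R) :
  continuous g -> (forall x, 0 <= g x) -> 0 < g x0 ->
  (0 < \int[@lebesgue_measure R]_x (g x)%:E)%E.
Proof.
move=> cg g0 gx0.
have mg : measurable_fun setT (EFin \o g).
  by apply/measurable_EFinP; exact: continuous_measurable_fun.
have /cvgrPdist_lt/(_ (g x0 / 2)) := cg x0; rewrite divr_gt0// => /(_ isT).
move=> /nbhs_ballP[d /= d0 hd].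
pose A : set R := `]x0 - d, x0 + d[%classic.
have mA : measurable A by exact: measurable_itv.
apply: (@lt_le_trans _ _ (\int[@lebesgue_measure R]_(x in A) (g x0 / 2)%:E)%E).
  rewrite integral_cst//= lebesgue_measure_itv /= lte_fin ltrBlDr -addrA.
  rewrite ltrDl addr_gt0// -EFinB -EFinM lte_fin mulr_gt0 ?divr_gt0//.
  lra.
apply: (@le_trans _ _ (\int[@lebesgue_measure R]_(x in A) (g x)%:E)%E).
  apply: ge0_le_integral => //.
  - by move=> x _; rewrite lee_fin divr_ge0// ltW.
  - exact: measurable_funTS.
  - move=> x /= xA; rewrite lee_fin.
    have /hd /= : ball x0 d x by rewrite ball_itv.
    by move=> h; have := ler_norm (g x0 - g x); lra.
by apply: ge0_subset_integral => // x _; rewrite lee_fin.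
Qed.

(** [tanh] is injective, so vanishing identically would give too many roots. *)
Lemma poly_tanh_neq0 (R : realType) (p : {poly R}) :
  p != 0 -> exists x, p.[tanh x] != 0.
Proof.
move=> p0; apply/not_existsP => h.
pose rs : seq R := [seq tanh (i%:R : R) | i <- iota 0 (size p)].
have prs : all (root p) rs.
  apply/allP => _ /mapP[i _ ->]; rewrite rootE.
  by apply/negPn/negP => /h.
have urs : uniq rs.
  rewrite map_inj_uniq ?iota_uniq// => i j /eqP; apply: contraTeq.
  rewrite neq_ltn => /orP[] ij.
    by rewrite lt_eqF// ltr_tanh// ltr_nat.
  by rewrite gt_eqF// ltr_tanh// ltr_nat.
by have := max_poly_roots p0 prs urs; rewrite size_map size_iota ltnn.
Qed.

Lemma jacobi_sqnormE (R : realType) (alpha beta : R) (m : nat) :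
  jacobi_sqnorm alpha beta m =
  \int[@lebesgue_measure R]_x (tanh_weight (alpha + 1) (beta + 1) x *
     (jacobi alpha beta m * jacobi alpha beta m).[tanh x]).
Proof.
rewrite /jacobi_sqnorm /Rintegral; congr fine.
rewrite -integral_jacobi_weight.
  by apply: eq_integral => t _; rewrite /jacobi_weighted hornerM expr2.
by move=> t; rewrite hornerM -expr2 sqr_ge0.
Qed.

(** The integrand is continuous, non-negative and not identically zero. *)
Lemma jacobi_sqnorm_gt0 (R : realType) (alpha beta : R) (m : nat) :
  -1 < alpha -> -1 < beta -> 0 < jacobi_sqnorm alpha beta m.
Proof.
move=> ha hb; have a0 : 0 < alpha + 1 by lra. have b0 : 0 < beta + 1 by lra.
rewrite jacobi_sqnormE /Rintegral fine_gt0//; apply/andP; split; last first.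
  by rewrite -ge0_fin_numE; [exact/integrable_fin_num/integrable_tanh_weight_poly|
    apply: integral_ge0 => x _; rewrite lee_fin hornerM -expr2 mulr_ge0 ?tanh_weight_ge0 ?sqr_ge0].
have [|x hx] := @poly_tanh_neq0 R (jacobi alpha beta m).
  by rewrite -size_poly_eq0 size_jacobi.
apply: (@integral_continuous_gt0 _ _ x).
- exact: continuous_tanh_weight_poly.
- by move=> y; rewrite hornerM -expr2 mulr_ge0 ?tanh_weight_ge0 ?sqr_ge0.
- by rewrite hornerM -expr2 mulr_gt0 ?tanh_weight_gt0// exprn_even_gt0//= hx.
Qed.

Lemma tanh_weight_half (R : realType) (a b x : R) :
  tanh_weight (a / 2) (b / 2) x * tanh_weight (a / 2) (b / 2) x = tanh_weight a b x.
Proof.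
have powRh (c u : R) : 0 < u -> u `^ (c / 2) * u `^ (c / 2) = u `^ c.
  move=> u0; rewrite -powRD -?splitr//.
  by apply/implyP => _; rewrite gt_eqF.
rewrite /tanh_weight -(powRh a _ (one_sub_tanh_gt0 x)).
by rewrite -(powRh b _ (one_add_tanh_gt0 x)); ring.
Qed.

(** Half exponents, so that products of two such functions carry the weight
    [tanh_weight a b]. *)
Definition tanh_poly (R : realType) (a b : R) (p : {poly R}) (x : R) : R :=
  tanh_weight (a / 2) (b / 2) x * p.[tanh x].

Lemma tanh_polyM (R : realType) (a b : R) (p q : {poly R}) (x : R) :
  tanh_poly a b p x * tanh_poly a b q x = tanh_weight a b x * (p * q).[tanh x].
Proof. by rewrite /tanh_poly mulrACA tanh_weight_half hornerM. Qed.

Lemma tanh_poly_L2 (R : realType) (a b : R) (p : {poly R}) : 0 < a -> 0 < b ->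
  tanh_poly a b p \in L2 R.
Proof.
move=> a0 b0; apply/L2P; split.
  by apply: continuous_measurable_fun; exact: continuous_tanh_weight_poly.
have := integrable_tanh_weight_poly (p * p) a0 b0.
by apply: eq_integrable => // x _; rewrite /= expr2 tanh_polyM.
Qed.

Definition tanh_jacobi_scale (R : realType) (alpha beta : R) (m : nat) : R :=
  (-1) ^+ m / Num.sqrt (jacobi_sqnorm alpha beta m).

Lemma tanh_jacobiE (R : realType) (alpha beta : R) (m : nat) (x : R) :
  tanh_jacobi alpha beta m x = tanh_jacobi_scale alpha beta m *
    tanh_poly (alpha + 1) (beta + 1) (jacobi alpha beta m) x.
Proof. by rewrite /tanh_jacobi /tanh_poly /tanh_weight !mulrA. Qed.

Lemma tanh_jacobi_scale_sqr (R : realType) (alpha beta : R) (m : nat) :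
  -1 < alpha -> -1 < beta ->
  tanh_jacobi_scale alpha beta m ^+ 2 = (jacobi_sqnorm alpha beta m)^-1.
Proof.
move=> ha hb; rewrite /tanh_jacobi_scale expr_div_n sqr_sqrtr; last first.
  exact/ltW/jacobi_sqnorm_gt0.
by rewrite -exprM mulnC exprM sqrrN expr1n expr1n mul1r.
Qed.

Lemma tanh_jacobi_orthonormal (R : realType) (alpha beta : R) :
  -1 < alpha -> -1 < beta -> orthonormal_system (tanh_jacobi alpha beta).
Proof.
move=> ha hb; have a0 : 0 < alpha + 1 by lra. have b0 : 0 < beta + 1 by lra.
split=> [m|m n].
  rewrite (_ : tanh_jacobi _ _ m = fun x => tanh_jacobi_scale alpha beta m *
    tanh_poly (alpha + 1) (beta + 1) (jacobi alpha beta m) x).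
    exact/L2_scale/tanh_poly_L2.
  by apply/funext => x; rewrite tanh_jacobiE.
rewrite /L2dot.
under eq_Rintegral do rewrite !tanh_jacobiE mulrACA tanh_polyM.
rewrite RintegralZl//; last exact: integrable_tanh_weight_poly.
have [<-|mn] := eqVneq m n; last by rewrite jacobi_orthogonal// mulr0.
rewrite -jacobi_sqnormE -expr2 tanh_jacobi_scale_sqr// mulVf//.
by rewrite gt_eqF// jacobi_sqnorm_gt0.
Qed.

(** * Approximation in mean square by weighted polynomials of tanh *)

(** The squared distance of L2, extended-valued so that comparisons need only
    measurability. *)
Definition sqdist (R : realType) (f g : R -> R) : \bar R :=
  (\int[@lebesgue_measure R]_x ((f x - g x) ^+ 2)%:E)%E.

Lemma measurable_sqdiff (R : realType) (f g : R -> R) :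
  measurable_fun setT f -> measurable_fun setT g ->
  measurable_fun setT (fun x => ((f x - g x) ^+ 2)%:E).
Proof.
move=> mf mg; apply/measurable_EFinP.
by apply: measurable_funX; exact: measurable_funB.
Qed.

Lemma sqdist_triangle (R : realType) (f g h : R -> R) :
  measurable_fun setT f -> measurable_fun setT g -> measurable_fun setT h ->
  (sqdist f h <= 2%:E * (sqdist f g + sqdist g h))%E.
Proof.
move=> mf mg mh; rewrite /sqdist -ge0_integralD//; last 4 first.
- by move=> x _; rewrite lee_fin sqr_ge0.
- exact: measurable_sqdiff.
- by move=> x _; rewrite lee_fin sqr_ge0.
- exact: measurable_sqdiff.
rewrite -ge0_integralZl//; last 2 first.
- by apply: emeasurable_funD; exact: measurable_sqdiff.
- by move=> x _; rewrite -EFinD lee_fin addr_ge0 ?sqr_ge0.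
apply: ge0_le_integral => //.
- by move=> x _; rewrite lee_fin sqr_ge0.
- exact: measurable_sqdiff.
- apply: emeasurable_funM => //.
  by apply: emeasurable_funD; exact: measurable_sqdiff.
- move=> x _; rewrite -EFinD -EFinM lee_fin.
  have := sqr_ge0 ((f x - g x) - (g x - h x)); lra.
Qed.

Definition tanh_poly_approx (R : realType) (a b : R) (f : R -> R) : Prop :=
  forall e : R, 0 < e -> exists p, (sqdist f (tanh_poly a b p) < e%:E)%E.

Lemma continuous_tanh_poly (R : realType) (a b : R) (p : {poly R}) :
  continuous (tanh_poly a b p).
Proof. exact: continuous_tanh_weight_poly. Qed.

Lemma tanh_poly_approx_closed (R : realType) (a b : R) (f : R -> R) :
  measurable_fun setT f ->
  (forall e : R, 0 < e -> exists g, [/\ measurable_fun setT g,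
     (sqdist f g < e%:E)%E & tanh_poly_approx a b g]) ->
  tanh_poly_approx a b f.
Proof.
move=> mf hf e e0; have e40 : 0 < e / 4 by rewrite divr_gt0.
have [g [mg fg /(_ _ e40)[p gp]]] := hf _ e40.
exists p; apply: le_lt_trans (sqdist_triangle mf mg _) _.
  by apply: continuous_measurable_fun; exact: continuous_tanh_poly.
have -> : e = 2 * (e / 4 + e / 4) by field.
rewrite EFinM lte_pmul2l// ?lte_fin// EFinD.
exact: lteD.
Qed.

(** A uniform error [d] on [[-1, 1]] costs at most [d^2] times the integral of
    the weight. *)
Lemma tanh_poly_approx_continuous (R : realType) (a b : R) (h : R -> R) :
  0 < a -> 0 < b -> continuous h ->
  tanh_poly_approx a b (fun x => tanh_weight (a / 2) (b / 2) x * h (tanh x)).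
Proof.
move=> a0 b0 ch e e0; have intW := integrable_tanh_weight a0 b0.
pose I := \int[@lebesgue_measure R]_x tanh_weight a b x.
have I0 : 0 <= I by apply: Rintegral_ge0 => x _; exact: tanh_weight_ge0.
pose d := Num.sqrt (e / (I + 1)).
have d0 : 0 < d by rewrite sqrtr_gt0 divr_gt0//; lra.
have dE : d ^+ 2 = e / (I + 1) by rewrite sqr_sqrtr// divr_ge0//; lra.
have [p hp] := weierstrass ch d0; exists p.
apply: (@le_lt_trans _ _ (\int[@lebesgue_measure R]_x (d ^+ 2 * tanh_weight a b x)%:E)%E).
  apply: ge0_le_integral => //.
  - by move=> x _; rewrite lee_fin sqr_ge0.
  - apply: measurable_sqdiff; apply: continuous_measurable_fun.
      move=> x; apply: cvgM; first exact: continuous_tanh_weight.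
      by apply: continuous_comp; [exact: continuous_tanh|exact: ch].
    exact: continuous_tanh_poly.
  - apply/measurable_EFinP/measurable_funM => //.
    by apply: continuous_measurable_fun; exact: continuous_tanh_weight.
  - move=> x _; rewrite lee_fin /tanh_poly -mulrBr exprMn.
    rewrite [X in X * _]expr2 tanh_weight_half mulrC.
    rewrite ler_wpM2r ?tanh_weight_ge0// -[leLHS]real_normK ?num_real//.
    have := hp _ (tanh_itv x); apply: lerXn2r; rewrite nnegrE//; exact: ltW.
under eq_integral do rewrite EFinM.
rewrite integralZl// -(fineK (integrable_fin_num _ intW))//.
rewrite -EFinM lte_fin dE -[fine _]/I mulrAC ltr_pdivrMr; last exact: ltr_wpDl.
by rewrite ltr_pM2l// ltrDl.
Qed.

(** For [M >= 0] this clamps [y] to [[-M, M]]; the formula makes its continuity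
    immediate. *)
Definition truncate (R : realType) (M y : R) : R := (`|y + M| - `|y - M|) / 2.

Lemma continuous_truncate (R : realType) (M : R) : continuous (truncate M).
Proof.
move=> y; apply: cvgMl; apply: cvgB; apply: cvg_norm.
  by apply: cvgD; [exact: cvg_id|exact: cvg_cst].
by apply: cvgB; [exact: cvg_id|exact: cvg_cst].
Qed.

Lemma truncate_id (R : realType) (M y : R) : `|y| <= M -> truncate M y = y.
Proof.
rewrite ler_norml => /andP[h1 h2]; rewrite /truncate ger0_norm; last by lra.
by rewrite ler0_norm; lra.
Qed.

Lemma truncate_ge (R : realType) (M y : R) : 0 <= M -> M <= y -> truncate M y = M.
Proof. by move=> M0 My; rewrite /truncate !ger0_norm; lra. Qed.

Lemma truncate_le (R : realType) (M y : R) : 0 <= M -> y <= - M -> truncate M y = - M.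
Proof. by move=> M0 My; rewrite /truncate !ler0_norm; lra. Qed.

Lemma truncate_bound (R : realType) (M y : R) : 0 <= M -> `|truncate M y| <= M.
Proof.
move=> M0; have [yM|/ltW yM] := leP `|y| M; first by rewrite truncate_id.
have [y0|/ltW y0] := leP 0 y.
  by rewrite truncate_ge ?ger0_norm// -(ger0_norm y0).
by rewrite truncate_le ?normrN ?ger0_norm// lerNr -(ler0_norm y0).
Qed.

Lemma truncate_dist (R : realType) (M v y : R) :
  `|v| <= M -> `|v - truncate M y| <= `|v - y|.
Proof.
move=> vM; have M0 : 0 <= M := le_trans (normr_ge0 v) vM.
have [yM|/ltW yM] := leP `|y| M; first by rewrite truncate_id.
move: vM; rewrite ler_norml => /andP[v1 v2].
have [y0|/ltW y0] := leP 0 y.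
  rewrite (ger0_norm y0) in yM; rewrite truncate_ge// !ler0_norm; lra.
rewrite (ler0_norm y0) in yM; rewrite truncate_le ?ger0_norm; lra.
Qed.

Definition artanh (R : realType) (t : R) : R := ln ((1 + t) / (1 - t)) / 2.

Lemma tanhK (R : realType) : cancel (@tanh R) (@artanh R).
Proof.
move=> x; rewrite /artanh one_sub_tanhE one_add_tanhE.
have c0 := lt0r_neq0 (cosh_gt0 x); have e0 := lt0r_neq0 (expR_gt0 (- x)).
have -> : 2 * expR x / (expR x + expR (- x)) /
   (2 * expR (- x) / (expR x + expR (- x))) = expR x / expR (- x).
  by field; rewrite c0 e0.
by rewrite expRN invrK -expRD expRK; field.
Qed.

Lemma continuous_artanh (R : realType) (t : R) : -1 < t < 1 -> {for t, continuous (@artanh R)}.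
Proof.
move=> /andP[t1 t2]; apply: cvgMl.
have h : {for t, continuous ((@ln R) \o (fun y => (1 + y) / (1 - y)))}.
  apply: continuous_comp.
    apply: cvgM; first by apply: cvgD; [exact: cvg_cst|exact: cvg_id].
    apply: cvgV; first by rewrite gt_eqF//; lra.
    by apply: cvgB; [exact: cvg_cst|exact: cvg_id].
  by apply: continuous_ln; rewrite divr_gt0//; lra.
exact: h.
Qed.

(** Take [g o artanh], with its argument clamped to [[- tanh N, tanh N]]: beyond
    these points [g] vanishes, so the clamping does not change the value. *)
Lemma factor_through_tanh (R : realType) (g : R -> R) (N : R) :
  0 < N -> continuous g -> (forall x, N <= `|x| -> g x = 0) ->
  exists2 h : R -> R, continuous h & forall x, h (tanh x) = g x.
Proof.
move=> N0 cg gN; have T1 : -1 < tanh N < 1.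
  have := one_sub_tanh_gt0 N; have := one_add_tanh_gt0 N => ? ?.
  by apply/andP; split; lra.
have tanh0 : tanh (0 : R) = 0 by rewrite /tanh oppr0 subrr mul0r.
have T0 : 0 <= tanh N by rewrite -tanh0 ltW// ltr_tanh.
have le_tanh (x y : R) : x <= y -> tanh x <= tanh y := ltW_homo (@ltr_tanh R) (y:=y).
exists (fun t => g (artanh (truncate (tanh N) t))).
  move=> t.
  have h : {for t, continuous (g \o (@artanh R \o truncate (tanh N)))}.
    apply: continuous_comp; last exact: cg.
    apply: continuous_comp; first exact: continuous_truncate.
    apply: continuous_artanh; have := truncate_bound t T0.
    move: T1 => /andP[? ?]; rewrite ler_norml => /andP[? ?].
    by apply/andP; split; lra.
  exact: h.
move=> x; have [xN|/ltW Nx] := leP `|x| N.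
  rewrite truncate_id ?tanhK//; move: xN; rewrite !ler_norml -tanhN.
  by move=> /andP[? ?]; rewrite !le_tanh.
rewrite (gN x)//; have [x0|/ltW x0] := leP 0 x.
  by rewrite truncate_ge ?tanhK ?gN ?le_tanh ?ger0_norm ?(ltW N0)// -(ger0_norm x0).
rewrite truncate_le// -tanhN ?tanhK ?gN ?normrN ?ger0_norm ?(ltW N0)//.
by rewrite le_tanh// lerNr -(ler0_norm x0).
Qed.

(** A trapezoid: 1 where [|x| <= N], 0 where [|x| >= N + 1], linear between. *)
Definition cutoff (R : realType) (N x : R) : R := (1 + truncate 1 (2 * (N - `|x|) + 1)) / 2.

Lemma continuous_cutoff (R : realType) (N : R) : continuous (cutoff N).
Proof.
move=> x; apply: cvgMl; apply: cvgD; first exact: cvg_cst.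
have h : {for x, continuous (truncate 1 \o (fun y => 2 * (N - `|y|) + 1))}.
  apply: continuous_comp; last exact: continuous_truncate.
  apply: cvgD; last exact: cvg_cst.
  apply: cvgMr; apply: cvgB; first exact: cvg_cst.
  by apply: cvg_norm; exact: cvg_id.
exact: h.
Qed.

Lemma cutoff_in (R : realType) (N x : R) : `|x| <= N -> cutoff N x = 1.
Proof. by move=> xN; rewrite /cutoff truncate_ge//; lra. Qed.

Lemma cutoff_out (R : realType) (N x : R) : N + 1 <= `|x| -> cutoff N x = 0.
Proof. by move=> xN; rewrite /cutoff truncate_le//; lra. Qed.

Lemma cutoff_itv (R : realType) (N x : R) : 0 <= cutoff N x <= 1.
Proof.
have := truncate_bound (2 * (N - `|x|) + 1) (@ler01 R).
by rewrite /cutoff ler_norml => /andP[? ?]; apply/andP; split; lra.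
Qed.

(** Approximate [u] in mean by a continuous function on [[-(N+1), N+1]].  Clamping
    it to [[-M, M]] and multiplying by the cutoff does not increase the pointwise
    error, and makes that error at most [2 M], so that the squared error is
    controlled by the error in mean. *)
Lemma tanh_poly_approx_bounded (R : realType) (a b M N : R) (u : R -> R) :
  0 < a -> 0 < b -> 0 < M -> 0 < N ->
  measurable_fun setT u -> (forall x, `|u x| <= M) ->
  (forall x, N < `|x| -> u x = 0) ->
  tanh_poly_approx a b (fun x => tanh_weight (a / 2) (b / 2) x * u x).
Proof.
move=> a0 b0 M0 N0 mu uM uN.
have mw : measurable_fun setT (@tanh_weight R (a / 2) (b / 2)).
  by apply: continuous_measurable_fun; exact: continuous_tanh_weight.
apply: tanh_poly_approx_closed; first exact: measurable_funM.
move=> e e0.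
pose E : set R := `[- (N + 1), N + 1]%classic.
have mE : measurable E by exact: measurable_itv.
have Efin : (@lebesgue_measure R E < +oo)%E.
  by rewrite lebesgue_measure_itv; case: ifP => _; rewrite ?ltry// -EFinB ltry.
have intu : (@lebesgue_measure R).-integrable E (EFin \o u).
  apply: measurable_bounded_integrable => //; first exact: measurable_funTS.
  exists M; split; first exact: num_real.
  by move=> y My x _ /=; apply: le_trans (uM x) _; exact: ltW.
pose K := 2 `^ a * 2 `^ b.
have K0 : 0 < K by rewrite mulr_gt0// powR_gt0.
have WK (x : R) : tanh_weight a b x <= K.
  apply: le_trans (tanh_weight_le x (ltW a0) (ltW b0)) _.
  rewrite ler_wpM2r ?powR_ge0//; have := one_sub_tanh_gt0 x.
  have := one_add_tanh_gt0 x => ? ?.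
  by apply: ge0_ler_powR; rewrite ?nnegrE ?ltW//; lra.
pose c := K * (2 * M).
have c0 : 0 < c by rewrite !mulr_gt0.
have [g_ [cg_ intg_ cvg_]] := approximation_continuous_integrable mE Efin intu.
have [n hn] : exists n,
    (\int[@lebesgue_measure R]_(x in E) `|(u x - g_ n x)%:E| < (e / c)%:E)%E.
  move/fine_cvgP : cvg_ => [[n1 _ fin1] /cvgr0Pnorm_lt/(_ _ (divr_gt0 e0 c0))[n2 _ h2]].
  exists (maxn n1 n2); rewrite -(fineK (fin1 _ (leq_maxl _ _))) lte_fin.
  by apply: le_lt_trans (ler_norm _) _; exact: h2 _ (leq_maxr _ _).
pose g x := truncate M (g_ n x) * cutoff N x.
have cg : continuous g.
  move=> x; apply: cvgM; last exact: continuous_cutoff.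
  have h : {for x, continuous (truncate M \o g_ n)}.
    by apply: continuous_comp; [exact: cg_|exact: continuous_truncate].
  exact: h.
have gout x : N + 1 <= `|x| -> g x = 0.
  by move=> h; rewrite /g cutoff_out// mulr0.
have ugE x : u x - g x = (u x - truncate M (g_ n x)) * cutoff N x.
  rewrite /g mulrBl; congr (_ - _).
  have [xN|Nx] := leP `|x| N; first by rewrite cutoff_in// mulr1.
  by rewrite uN// mul0r.
have [h ch hg] := factor_through_tanh (ltr_wpDl (ltW N0) ltr01) cg gout.
have mg : measurable_fun setT g by exact: continuous_measurable_fun.
exists (fun x => tanh_weight (a / 2) (b / 2) x * g x); split.
- exact: measurable_funM.
- have mabs : measurable_fun E (fun x => `|(u x - g_ n x)%:E|)%E.
    apply: measurableT_comp => //; apply/measurable_EFinP.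
    apply: measurable_funB; first exact: measurable_funTS.
    by apply: measurable_funTS; apply: continuous_measurable_fun; exact: cg_.
  apply: (@le_lt_trans _ _ (\int[@lebesgue_measure R]_(x in E)
      (c%:E * `|(u x - g_ n x)%:E|))%E); last first.
    rewrite ge0_integralZl// ?lee_fin ?ltW//.
    rewrite (_ : e = c * (e / c)); last by rewrite mulrC divfK// gt_eqF.
    by rewrite (EFinM c (e / c)) lte_pmul2l// lte_fin.
  rewrite [leRHS]integral_mkcond; apply: ge0_le_integral => //.
  + by move=> x _; rewrite lee_fin sqr_ge0.
  + by apply: measurable_sqdiff; exact: measurable_funM.
  + apply/(measurable_restrictT (fun x => c%:E * `|(u x - g_ n x)%:E|)%E).
      exact: mE.
    exact: emeasurable_funM.
  + move=> x _; rewrite patchE -mulrBr exprMn [X in X * _]expr2 tanh_weight_half.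
    case: ifPn => [_|/negP xE]; last first.
      have xN1 : N + 1 < `|x|.
        by rewrite ltNge; apply/negP => xN; apply: xE; rewrite inE /E /= in_itv /= -ler_norml.
      have ux0 : u x = 0 by apply: uN; lra.
      have gx0 : g x = 0 by apply/gout/ltW.
      by rewrite ux0 gx0 subrr expr0n mulr0.
    rewrite abse_EFin -EFinM lee_fin /c -[leRHS]mulrA.
    have /andP[q0 q1] := cutoff_itv N x.
    have hd : `|u x - g x| <= `|u x - truncate M (g_ n x)|.
      by rewrite ugE normrM (ger0_norm q0) ler_piMr.
    have hd1 : `|u x - g x| <= `|u x - g_ n x| := le_trans hd (truncate_dist _ (uM x)).
    have hd2 : `|u x - g x| <= 2 * M.
      apply: le_trans hd _; apply: le_trans (ler_normB _ _) _.
      by have := uM x; have := truncate_bound (g_ n x) (ltW M0); lra.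
    have hsq : (u x - g x) ^+ 2 <= 2 * M * `|u x - g_ n x|.
      by rewrite -[leLHS]real_normK ?num_real// expr2 ler_pM.
    by apply: ler_pM => //; [exact: tanh_weight_ge0|exact: sqr_ge0].
- have -> : g = h \o @tanh R by apply/funext => x; rewrite /= hg.
  exact: tanh_poly_approx_continuous.
Qed.

(** Cutting [f] where [|x|] or [|f| / w] is large leaves [w u] with [u] bounded of
    bounded support; the error tends to 0 by dominated convergence. *)
Lemma tanh_poly_approx_L2 (R : realType) (a b : R) (f : R -> R) :
  0 < a -> 0 < b -> f \in L2 R -> tanh_poly_approx a b f.
Proof.
move=> a0 b0 /L2P[mf intf2].
pose w := @tanh_weight R (a / 2) (b / 2).
have w0 x : 0 < w x by exact: tanh_weight_gt0.
have cw : continuous w by exact: continuous_tanh_weight.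
have mw : measurable_fun setT w by exact: continuous_measurable_fun.
pose P n x := (`|x| <= n.+1%:R) && (`|f x| <= n.+1%:R * w x).
pose u n x := if P n x then f x * (w x)^-1 else 0.
have mwV : measurable_fun setT (fun x => (w x)^-1).
  by apply: continuous_measurable_fun => x; apply: cvgV; [rewrite gt_eqF|exact: cw].
have mP n : measurable_fun setT (P n).
  apply: measurable_and; apply: measurable_fun_ler => //.
  - exact: measurableT_comp.
  - exact: measurable_funM.
have mu n : measurable_fun setT (u n).
  by apply: measurable_fun_ifT => //; exact: measurable_funM.
have wuE n x : w x * u n x = if P n x then f x else 0.
  rewrite /u; case: ifP => _; last by rewrite mulr0.
  by rewrite mulrCA divff ?mulr1// gt_eqF.
apply: tanh_poly_approx_closed => // e e0.
have hcvg : (sqdist f (fun x => w x * u n x)%R @[n --> \oo] --> 0)%E.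
  rewrite -(integral0 (@lebesgue_measure R) setT).
  apply: (@dominated_cvg _ _ _ (@lebesgue_measure R) setT measurableT _ _
    (fun x => (f x ^+ 2)%:E)) => //.
  - by move=> n; apply: measurable_sqdiff => //; exact: measurable_funM.
  - move=> x _; apply: cvg_near_cst.
    exists (maxn (Num.truncn `|x|) (Num.truncn (`|f x| / w x))) => // n /= nx.
    have nx1 : `|x| <= n.+1%:R.
      rewrite ltW// (lt_le_trans (truncnS_gt _))// ler_nat ltnS.
      exact: leq_trans (leq_maxl _ _) nx.
    have nx2 : `|f x| <= n.+1%:R * w x.
      rewrite -ler_pdivrMr// ltW// (lt_le_trans (truncnS_gt _))// ler_nat ltnS.
      exact: leq_trans (leq_maxr _ _) nx.
    by rewrite wuE /P nx1 nx2 subrr expr0n.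
  - move=> n x _; rewrite wuE abse_EFin lee_fin ger0_norm ?sqr_ge0//.
    by case: ifP => _; rewrite ?subrr ?subr0// expr0n sqr_ge0.
have [n hn] : exists n, (sqdist f (fun x => w x * u n x)%R < e%:E)%E.
  move/fine_cvgP : hcvg => [[n1 _ fin1] /cvgr0Pnorm_lt/(_ _ e0)[n2 _ h2]].
  exists (maxn n1 n2); rewrite -(fineK (fin1 _ (leq_maxl _ _))) lte_fin.
  by apply: le_lt_trans (ler_norm _) _; exact: h2 _ (leq_maxr _ _).
exists (fun x => w x * u n x); split=> //; first exact: measurable_funM.
apply: (@tanh_poly_approx_bounded _ _ _ n.+1%:R n.+1%:R) => // x.
- rewrite /u /P; case: ifP => [/andP[_ h]|_]; last by rewrite normr0.
  rewrite normrM normfV (gtr0_norm (w0 x)).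
  by rewrite ler_pdivrMr.
- by move=> h; rewrite /u /P leNgt h.
Qed.

Lemma tanh_jacobi_complete (R : realType) (alpha beta : R) :
  -1 < alpha -> -1 < beta -> complete_system (tanh_jacobi alpha beta).
Proof.
move=> ha hb f fL e e0.
have a0 : 0 < alpha + 1 by lra. have b0 : 0 < beta + 1 by lra.
have [p hp] := tanh_poly_approx_L2 a0 b0 fL (exprn_gt0 2 e0).
have [c pE] := poly_span (fun m => size_jacobi m ha hb) (leqnn (size p)).
have k0 m : tanh_jacobi_scale alpha beta m != 0.
  rewrite -sqrf_eq0 tanh_jacobi_scale_sqr// invr_eq0.
  by rewrite gt_eqF// jacobi_sqnorm_gt0.
exists (size p), (fun m => c m / tanh_jacobi_scale alpha beta m).
have -> : (fun x => \sum_(m < size p)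
    c m / tanh_jacobi_scale alpha beta m * tanh_jacobi alpha beta m x) =
    tanh_poly (alpha + 1) (beta + 1) p.
  apply/funext => x; rewrite /tanh_poly [in RHS]pE horner_sum mulr_sumr.
  apply: eq_bigr => m _; rewrite tanh_jacobiE hornerZ /tanh_poly.
  by rewrite mulrA divfK// mulrCA.
have qL := tanh_poly_L2 p a0 b0.
rewrite L2dist_sqrt// lte_fin.
have hint := L2_mul_integrable (L2_sub fL qL) (L2_sub fL qL).
move: hp; rewrite /sqdist; under eq_integral do rewrite expr2.
rewrite -(fineK (integrable_fin_num _ hint))// lte_fin => hp.
rewrite -[ltRHS]ger0_norm ?ltW// -sqrtr_sqr ltr_sqrt// exprn_gt0//.
Qed.

Theorem mainTheorem4 (R : realType) (alpha beta : R)
    (halpha : -1 < alpha) (hbeta : -1 < beta) :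
  orthonormal_system (tanh_jacobi alpha beta) /\
  complete_system (tanh_jacobi alpha beta) /\
  orthonormal_basis (tanh_jacobi alpha beta).
Proof.
have orth := tanh_jacobi_orthonormal halpha hbeta.
have compl := tanh_jacobi_complete halpha hbeta.
by do 2 split=> //; exact: orthonormal_complete_basis.
Qed.
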